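(* Suppose that $A:(a,b)\to\mathbb{R}^{n\times n}$ is a matrix of locally (essentially) bounded measurable functions, with $A(t)\in\mathbb{Q}^+$ for almost all $t\in(a,b)$. Furthermore, suppose that there exists $\delta>0$ such that all the non-zero entries of $A(t)$ are larger than or equal to $\delta$ for almost all $t$. Then the system $\dot\Phi(t)=A(t)\Phi(t)$ is a cyclic variation diminishing differential system (CVDDS) on $(a,b)$.
   Context: Here $\mathbb{Q}^+\subset\mathbb{R}^{n\times n}$ (not the rationals) denotes the set of $n\times n$ real matrices that are Metzler (every off-diagonal entry is nonnegative), irreducible (the associated directed adjacency graph is strongly connected), and can have non-zero entries only on the main diagonal, the super-diagonal, the sub-diagonal, and in entries $(1,n)$ and $(n,1)$. Sign variations. For a vector $y\in\mathbb{R}^m$ with no zero entries, $\sigma(y)$ is the number of indices $k\in\{1,\dots,m-1\}$ with $y_ky_{k+1}<0$. For any $y\in\mathbb{R}^m$: $s^-(y):=\sigma(\bar y)$, where $\bar y$ is obtained from $y$ by deleting all zero entries (and $s^-(0):=0$); $s^+(y):=\max_{z\in P(y)}\sigma(z)$, where $P(y)$ is the set of vectors obtained from $y$ by replacing each zero entry by either $1$ or $-1$. Cyclic sign variations. For $y\in\mathbb{R}^n$, $$s_c^-(y):=\max_{i\in\{1,\dots,n\}} s^-\big([y_i,\dots,y_n,y_1,\dots,y_i]'\big),\qquad s_c^+(y):=\max_{i\in\{1,\dots,n\}} s^+\big([y_i,\dots,y_n,y_1,\dots,y_i]'\big),$$ where each bracketed vector has $n+1$ entries (it goes once around the ring, beginning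 and ending with $y_i$), and where in the definition of $s_c^+$, if $y_i=0$, then both copies of $y_i$ (the first and the last entry) are replaced by the same value, either $1$ or $-1$. SCVDP. A matrix $B\in\mathbb{R}^{n\times n}$ satisfies the strong cyclic variation diminishing property (SCVDP) if $s_c^+(Bx)\le s_c^-(x)$ for all $x\in\mathbb{R}^n\setminus\{0\}$. CVDDS. Let $\Phi(t,t_0)$ denote the transition matrix, i.e. the unique locally absolutely continuous solution of $\frac{d}{dt}\Phi(t,t_0)=A(t)\Phi(t,t_0)$ (for almost all $t$), $\Phi(t_0,t_0)=I$. The system $\dot x(t)=A(t)x(t)$ (equivalently, $\dot\Phi(t)=A(t)\Phi(t)$) is called a cyclic variation diminishing differential system (CVDDS) on $(a,b)$ if $\Phi(t,t_0)$ satisfies the SCVDP for every pair $(t_0,t)$ with $a<t_0<t<b$. *)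

(* Defs.v *)
From mathcomp Require Export all_boot all_order all_algebra.
From mathcomp Require Export all_classical all_reals all_analysis.
From mathcomp Require Export measurable_realfun.
Set Implicit Arguments.
Unset Strict Implicit.
Unset Printing Implicit Defensive.
Export Order.TTheory GRing.Theory Num.Theory.
Export numFieldNormedType.Exports.

Local Open Scope classical_set_scope.
Local Open Scope ring_scope.

Definition metzler (R : realType) n (M : 'M[R]_n) : Prop :=
  forall i j : 'I_n, i != j -> 0 <= M i j.

(* Self-loops do not affect connectivity, so the diagonal is not excluded. *)
Definition irreducible_mx (R : realType) n (M : 'M[R]_n) : Prop :=
  forall i j : 'I_n, connect [rel k l : 'I_n | M k l != 0] i j.

Definition cyclic_band n (i j : 'I_n) : bool :=
  [|| i == j, (j == i.+1 :> nat), (i == j.+1 :> nat),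
      (i == 0%N :> nat) && (j == n.-1 :> nat)
    | (i == n.-1 :> nat) && (j == 0%N :> nat)].

Definition in_Qplus (R : realType) n (M : 'M[R]_n) : Prop :=
  [/\ metzler M, irreducible_mx M
    & forall i j : 'I_n, M i j != 0 -> cyclic_band i j].

Definition sigma (R : realType) (y : seq R) : nat :=
  (\sum_(0 <= k < (size y).-1) (y`_k * y`_k.+1 < 0)%R)%N.

Definition s_minus (R : realType) (y : seq R) : nat :=
  sigma [seq v <- y | v != 0].

(* The set P(y) of all vectors obtained by replacing each zero entry of y
   by 1 or -1. *)
Fixpoint zero_fillings (R : realType) (y : seq R) : seq (seq R) :=
  if y is v :: y' then
    [seq w :: z | w <- (if v == 0 then [:: 1; -1] else [:: v]),
                  z <- zero_fillings y']
  else [:: [::]].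

(* [y_i, ..., y_n, y_1, ..., y_i] for the 0-based index i. *)
Definition ring_seq (R : realType) n (y : 'cV[R]_n) (i : 'I_n) : seq R :=
  rcons (rot i [seq y k 0 | k <- enum 'I_n]) (y i 0).

Definition sc_minus (R : realType) n (y : 'cV[R]_n) : nat :=
  \max_(i < n) s_minus (ring_seq y i).

(* The condition on the first and last entries forces both copies of y_i to be
   replaced by the same value; it holds automatically when y_i != 0. *)
Definition sc_plus (R : realType) n (y : 'cV[R]_n) : nat :=
  \max_(i < n)
    \max_(z <- zero_fillings (ring_seq y i) | (head 0 z == last 0 z)%R)
      sigma z.

Definition SCVDP (R : realType) n (B : 'M[R]_n) : Prop :=
  forall x : 'cV[R]_n, x != 0 -> (sc_plus (B *m x) <= sc_minus x)%N.

(* The endpoints may be infinite. *)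
Definition open_itv (R : realType) (a b : \bar R) : set R :=
  [set t | (a < t%:E)%E /\ (t%:E < b)%E].

(* Measurability with respect to the Lebesgue sigma-algebra (not only the Borel
   one): the domain carries the completion of the Borel sigma-algebra by
   Lebesgue-negligible sets. *)
Definition lebesgue_measurable_fun (R : realType) (D : set R) (f : R -> R) :=
  @measurable_fun _ _
    (g_sigma_algebraType (completed_algebra_gen (@lebesgue_measure R)))
    (measurableTypeR R) D f.

Definition locally_ess_bounded (R : realType) (a b : \bar R) (f : R -> R) :=
  forall c d : R, open_itv a b c -> open_itv a b d ->
    exists M : R, {ae @lebesgue_measure R, forall t, c <= t <= d -> `|f t| <= M}.

Definition abs_continuous_on (R : realType) (c d : R) (f : R -> R) : Prop :=
  forall e : R, 0 < e -> exists2 r : R, 0 < r &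
    forall (N : nat) (u v : 'I_N -> R),
      (forall k, [/\ c <= u k, u k <= v k & v k <= d]) ->
      trivIset [set: 'I_N] (fun k => `]u k, v k[%classic) ->
      \sum_(k < N) (v k - u k) < r ->
      \sum_(k < N) `|f (v k) - f (u k)| < e.

Definition locally_abs_continuous (R : realType) (a b : \bar R) (f : R -> R) :=
  forall c d : R, open_itv a b c -> open_itv a b d -> abs_continuous_on c d f.

(* [Phi] is the map t |-> Phi(t, t0) on (a, b); its values outside (a, b) are
   irrelevant. *)
Definition is_transition_matrix (R : realType) n (a b : \bar R)
    (A : R -> 'M[R]_n) (t0 : R) (Phi : R -> 'M[R]_n) : Prop :=
  [/\ forall i j, locally_abs_continuous a b (fun t => Phi t i j),
      Phi t0 = 1%:M
    & {ae @lebesgue_measure R, forall t, open_itv a b t -> forall i j,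
        is_derive t 1 (fun s => Phi s i j) ((A t *m Phi t) i j)}].

Definition CVDDS (R : realType) n (a b : \bar R) (A : R -> 'M[R]_n) : Prop :=
  forall (t0 t : R), open_itv a b t0 -> open_itv a b t -> t0 < t ->
    forall Phi : R -> 'M[R]_n,
      is_transition_matrix a b A t0 Phi -> SCVDP (Phi t).

(* Main.v *)
Require Import Defs.
From mathcomp Require Import all_boot all_order all_algebra.
From mathcomp Require Import all_classical all_reals all_analysis.
From mathcomp Require Import lra ring zify.
Import Order.TTheory GRing.Theory Num.Theory.

Set Implicit Arguments.
Unset Strict Implicit.
Unset Printing Implicit Defensive.

Local Open Scope classical_set_scope.
Local Open Scope ring_scope.

(* The number of cyclic sign changes s_c^- does not increase along x' = A x.
   Over a step of length h the solution equals (1 + h C) x + O(h^2) with C >= 0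
   off the diagonal and supported on the cyclic band, and 1 + h C is, up to
   O(h^2), a product of matrices 1 + h C_ij E_ij.  For i <> j such a factor adds
   to one coordinate a nonnegative multiple of a neighbouring one, which does not
   increase s_c^-.  Since s_c^- is lower semicontinuous, letting h tend to 0
   gives s_c^-(x(t)) <= s_c^-(x(s)) for s <= t.

   To replace s_c^-(x(t)) by s_c^+(x(t)), one uses a time s at which every zero
   coordinate of x(s) lies between neighbours of opposite signs: s_c^- cannot
   increase under small perturbations of x(s), and every filling of the zeros of
   x(t) is reached, up to positive scaling, from such a perturbation.  If no such
   time existed, some coordinate would vanish on a subinterval with neighbours
   of the same weak sign; irreducibility of A then forces this arc of zeros to
   grow, on smaller and smaller subintervals, until x = 0. *)

(** * Absolutely continuous functions with bounded derivative *)

(** Compactness of [[c, d]] in the form of an induction: if the supremum of the [t] with [Q c t]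
    were below [d], the local hypothesis there, applied across the supremum, would carry [Q c] past
    it. *)
Lemma interval_additive_ind (R : realType) (Q : R -> R -> Prop) (c d : R) :
  c <= d ->
  (forall s t u, s <= t -> t <= u -> Q s t -> Q t u -> Q s u) ->
  (forall T, c <= T -> T <= d -> exists2 e : R, 0 < e &
     forall s t, c <= s -> s <= T -> T <= t -> t <= d ->
       T - s < e -> t - T < e -> Q s t) ->
  Q c d.
Proof.
move=> cd Qadd Qloc; pose S := [set t | [/\ c <= t, t <= d & Q c t]].
have Sc : S c.
  have [e e0 Qe] := Qloc c (lexx c) cd.
  by split=> //; apply: Qe => //; rewrite subrr.
have hS : has_sup S by split; [exists c | exists d => t []].
have cT : c <= sup S by apply: ub_le_sup => //; exists d => t [].
have Td : sup S <= d by apply: ge_sup; [exists c | move=> t []].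
have [e e0 Qe] := Qloc _ cT Td.
have [s [cs sd Qs] Tes] := sup_adherent e0 hS.
have sT : s <= sup S by apply: ub_le_sup; [exists d => t [] | split].
pose t := Num.min d (sup S + e / 2).
have Tt : sup S <= t by rewrite /t le_min Td /=; lra.
have td : t <= d by rewrite /t ge_min lexx.
have tS : t <= sup S + e / 2 by rewrite /t ge_min lexx orbT.
have Qct : Q c t.
  by apply: (Qadd c s t) => //; [lra | apply: Qe => //; lra].
have tS' : t <= sup S.
  by apply: ub_le_sup; [exists d => ? [] | split => //; lra].
have [td'|tSe] : t = d \/ t = sup S + e / 2.
- by rewrite /t /Num.min; case: ifP => _; [left | right].
- by rewrite -td'.
- lra.
Qed.

(** A list is used because concatenation of chains matches the additivity required by
    [interval_additive_ind]. Gaps between consecutive intervals are allowed. *)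
Fixpoint interval_chain (R : realType) (U : set R) (s t : R) (l : seq (R * R)) :
    Prop :=
  if l is p :: l' then
    [/\ s <= p.1, p.1 <= p.2, `]p.1, p.2[%classic `<=` U
      & interval_chain U p.2 t l']
  else s <= t.

Section IntervalChain.
Context {R : realType} {U : set R}.
Implicit Types (s t u : R) (l : seq (R * R)).

Lemma interval_chain_le s t l : interval_chain U s t l -> s <= t.
Proof.
elim: l s => [//|[u v] l IH] s /= [su uv _ /IH]; lra.
Qed.

Lemma interval_chainWl s s' t l :
  s' <= s -> interval_chain U s t l -> interval_chain U s' t l.
Proof. by case: l => [|[u v] l] /= ?; [lra | case=> ? ? ? ?; split=> //;
  lra]. Qed.

Lemma interval_chain_cat s t u l l' :
  interval_chain U s t l -> interval_chain U t u l' ->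
  interval_chain U s u (l ++ l').
Proof.
elim: l s => [|p l IH] s /=; first exact: interval_chainWl.
by move=> [? ? ? cl] cl'; split=> //; exact: IH.
Qed.

Lemma interval_chain_nth s t l i (p := nth (0, 0) l i) :
  interval_chain U s t l -> (i < size l)%N ->
  [/\ s <= p.1, p.1 <= p.2, p.2 <= t & `]p.1, p.2[%classic `<=` U].
Proof.
rewrite {}/p; elim: l s i => [//|q l IH] s [|i] /= [sq qq qU cl].
  by move=> _; split=> //; exact: interval_chain_le cl.
by rewrite ltnS => /(IH _ _ cl) [? ? ? ?]; split=> //; lra.
Qed.

Lemma interval_chain_nth_lt s t l i j :
  interval_chain U s t l -> (i < j < size l)%N ->
  (nth (0, 0) l i).2 <= (nth (0, 0) l j).1.
Proof.
elim: l s i j => [s i j _|q l IH s [|i] [|j]] /=; rewrite ?ltn0 ?andbF//.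
  by move=> [_ _ _ cl] /= jl; have [] := interval_chain_nth cl jl.
by move=> [_ _ _ cl]; exact: IH cl.
Qed.

Lemma interval_chain_trivIset s t l : interval_chain U s t l ->
  trivIset [set: 'I_(size l)]
    (fun k => `](nth (0, 0) l k).1, (nth (0, 0) l k).2[%classic).
Proof.
move=> cl; apply/trivIsetP => i j _ _; wlog ij : i j / (i < j)%N => [wl ij|_].
  have /orP[h|h] : (i < j)%N || (j < i)%N by rewrite -neq_ltn.
    exact: wl.
  by rewrite setIC; apply: wl => //; rewrite eq_sym.
rewrite -subset0 => x [/=]; rewrite !in_itv /= => /andP[_ xi] /andP[xj _].
have := interval_chain_nth_lt (i := i) (j := j) cl; rewrite ij ltn_ord.
by move=> /(_ isT); lra.
Qed.

Lemma interval_chain_length s t l (r : R) : open U ->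
  (@lebesgue_measure R U < r%:E)%E -> interval_chain U s t l ->
  \sum_(k < size l) ((nth (0, 0) l k).2 - (nth (0, 0) l k).1) < r.
Proof.
move=> oU Ur cl; rewrite -lte_fin; apply: le_lt_trans Ur.
pose F (k : 'I_(size l)) : set R :=
  `](nth (0, 0) l k).1, (nth (0, 0) l k).2[%classic.
have mF k : measurable (F k) by exact: measurable_itv.
have -> : (\sum_(k < size l) ((nth (0, 0) l k).2 - (nth (0, 0) l k).1))%:E
    = (\sum_(k < size l) @lebesgue_measure R (F k))%E.
  rewrite -sumEFin; apply: eq_bigr => k _; rewrite /F lebesgue_measure_itv /=.
  have [_ h _ _] := interval_chain_nth cl (ltn_ord k).
  have [//|h'] := ltP (nth (0, 0) l k).1%:E (nth (0, 0) l k).2%:E.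
  rewrite lee_fin in h'.
  by rewrite (le_anti (introT andP (conj h' h))) subrr.
rewrite -(measure_bigsetU_ord (@lebesgue_measure R) xpredT mF
  (interval_chain_trivIset cl)).
apply: le_measure; rewrite ?inE.
- by apply: bigsetU_measurable => k _; exact: mF.
- exact: open_measurable.
- rewrite -bigcup_seq => x [k _ Fx].
  by have [_ _ _] := interval_chain_nth cl (ltn_ord k); exact.
Qed.

End IntervalChain.

Lemma is_derive_approx (R : realType) (f : R -> R) (x l e : R) : 0 < e ->
  is_derive x 1 f l ->
  exists2 r : R, 0 < r & forall y, `|y - x| < r ->
    `|f y - f x - l * (y - x)| <= e * `|y - x|.
Proof.
move=> e0 [df lE]; move: df => /cvg_ex[l' fl'].
have {lE} ll : l' = l by rewrite -lE; exact/esym/cvg_lim.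
rewrite {}ll in fl'; move/cvgrPdist_le: fl' => /(_ _ e0).
move=> /nbhs_ballP[r /= r0 rP]; exists r => // y yx.
have [->|xy] := eqVneq y x; first
  by rewrite !subrr mulr0 normr0 mulr0 subr0 normr0.
have y0 : y - x != 0 by rewrite subr_eq0.
have := rP (y - x); rewrite /ball /= sub0r normrN => /(_ yx y0).
rewrite /shift /= -![_ *: _]/(_ * _) mulr1 subrK.
rewrite -(ler_pM2r (x := `|y - x|)) ?normr_gt0// -normrM mulrBl.
by rewrite mulrAC mulVf// mul1r distrC.
Qed.

Lemma lebesgue_null_open (R : realType) (N : set R) (r : R) : 0 < r ->
  (@lebesgue_measure R).-negligible N ->
  exists U : set R, [/\ open U, N `<=` U & (@lebesgue_measure R U < r%:E)%E].
Proof.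
move=> r0 [N' [mN N0 NN]].
have [|U [oU NU UN]] := lebesgue_regularity_outer mN _ r0.
  by rewrite [X in (X < _)%E](_ : _ = 0%E)// ltry.
exists U; split=> //; first exact: subset_trans NU.
rewrite -(setDUK NU) measureU ?setDIK//; last first.
- by apply: measurableD => //; exact: open_measurable.
- by rewrite [X in (X + _)%E](_ : _ = 0%E)// add0e.
Qed.

(* The derivative controls [f] off a null set; the null set is covered by an
   open set of small measure, on which absolute continuity takes over. *)
Lemma ae_derive_le (R : realType) (f : R -> R) (c d L : R) : c <= d ->
  abs_continuous_on c d f ->
  {ae @lebesgue_measure R, forall t, c <= t <= d ->
     exists2 l : R, is_derive t 1 f l & l <= L} ->
  f d - f c <= L * (d - c).
Proof.
move=> cd fac fae; apply/ler_addgt0Pr => e e0.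
(* The error [e] is shared out as [e1] per unit of length, plus one [e1] for the variation over the
   chain and one for [K] times its length. *)
pose e1 := e / (d - c + 2).
have e10 : 0 < e1 by rewrite divr_gt0//; lra.
have e1E : e1 * (d - c) + e1 * 2 = e by rewrite -mulrDr divfK//; lra.
clearbody e1; have [r r0 rP] := fac _ e10.
(* [L + e1] may be negative; on an interval inside [U], [K] times the length compensates for
   [(L + e1) * (t - s)]. *)
pose K := `|L + e1| + 1; have K1 : 1 <= K by rewrite /K lerDr.
have LK : - K <= L + e1 by rewrite /K lerNl; have := ler_norm (- (L + e1));
  rewrite normrN; lra.
pose r' := Num.min r (e1 / K).
have r'0 : 0 < r' by rewrite /r' lt_min r0 divr_gt0//; lra.
have [U [oU NU Ur]] := lebesgue_null_open r'0 fae.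
pose len l := \sum_(k < size l) ((nth (0, 0) l k).2 - (nth (0, 0) l k).1 : R).
pose var l := \sum_(k < size l) `|f (nth (0, 0) l k).2 - f (nth (0, 0) l k).1|.
have lenD l l' : len (l ++ l') = len l + len l'.
  rewrite /len size_cat big_split_ord /=; congr (_ + _); apply: eq_bigr => k _.
    by rewrite nth_cat ltn_ord.
  by rewrite nth_cat ltnNge leq_addr /= addKn.
have varD l l' : var (l ++ l') = var l + var l'.
  rewrite /var size_cat big_split_ord /=; congr (_ + _); apply: eq_bigr => k _.
    by rewrite nth_cat ltn_ord.
  by rewrite nth_cat ltnNge leq_addr /= addKn.
pose Q s t := exists2 l, interval_chain U s t l &
  f t - f s <= (L + e1) * (t - s) + (var l + K * len l).
suff [l cl fl] : Q c d.
  have Sr : len l < r' := interval_chain_length oU Ur cl.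
  have lr : len l < r by apply: lt_le_trans Sr _; rewrite /r' ge_min lexx.
  have vl : var l < e1.
    apply: rP lr; last exact: interval_chain_trivIset cl.
    by move=> k; have [? ? ? _] := interval_chain_nth cl (ltn_ord k).
  have Kl : K * len l <= e1.
    have : len l <= e1 / K by apply: (le_trans (ltW Sr));
      rewrite /r' ge_min lexx orbT.
    by rewrite ler_pdivlMr 1?mulrC//; lra.
  by nra.
apply: interval_additive_ind => // [s t u st tu [l cl fl] [l' cl' fl']|T cT Td].
  exists (l ++ l'); first exact: interval_chain_cat cl'.
  by rewrite lenD varD; nra.
(* Near a point of [U] the whole interval becomes a chain. Elsewhere the derivative exists and the
   empty chain suffices. *)
have [UT|nUT] := pselect (U T).
  have /nbhs_ballP[q /= q0 qU] : nbhs T U by exact: open_nbhs_nbhs.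
  exists q => // s t cs sT Tt td sq tq; exists [:: (s, t)].
    split=> //=; first lra.
    move=> x /=; rewrite in_itv /= => /andP[sx xt]; apply: qU.
    by rewrite /ball /= ltr_norml; lra.
  rewrite /len /var /= !big_ord1 /=.
  have := ler_norm (f t - f s); nra.
have [l Tl lL] : exists2 l, is_derive T 1 f l & l <= L.
  apply: contrapT => nl; apply/nUT/NU => /= /(_ _)/nl; apply.
  by rewrite cT.
have [q q0 qP] := is_derive_approx e10 Tl.
exists q => // s t cs sT Tt td sq tq; exists [::] => /=; first lra.
rewrite /len /var /= !big_ord0 mulr0 !addr0.
have := qP s; have := qP t; rewrite [`|s - T|]ler0_norm ?[`|t - T|]ger0_norm;
  [|lra|lra].
move=> /(_ tq) /ler_normlP[_ h1] /(_ _)/ler_normlP[|h2 _]; first lra.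
nra.
Qed.

#[local] Instance ae_lebesgue_filter (R : realType) :
  Filter (almost_everywhere (@lebesgue_measure R)) := ae_filter_ringOfSetsType
    _.

Section AbsContinuous.
Context {R : realType}.
Implicit Types (f : R -> R) (c d L : R).

Lemma abs_continuous_onS f c d c' d' : c <= c' -> d' <= d ->
  abs_continuous_on c d f -> abs_continuous_on c' d' f.
Proof.
move=> cc dd fac e e0; have [r r0 rP] := fac e e0; exists r => // N u v uv.
by apply: rP => k; have [? ? ?] := uv k; split=> //; lra.
Qed.

Lemma abs_continuous_onN f c d :
  abs_continuous_on c d f -> abs_continuous_on c d (fun t => - f t).
Proof.
move=> fac e e0; have [r r0 rP] := fac e e0; exists r => // N u v uv tI uvr.
rewrite (eq_bigr (fun k => `|f (v k) - f (u k)|)) => [|k _]; first exact: rP.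
by rewrite -opprD normrN.
Qed.

Lemma abs_continuous_on_uniform f c d e : abs_continuous_on c d f -> 0 < e ->
  exists2 r, 0 < r & forall s t, c <= s -> s <= d -> c <= t -> t <= d ->
    `|t - s| < r -> `|f t - f s| < e.
Proof.
move=> fac e0; have [r r0 rP] := fac e e0; exists r => // s t.
wlog st : s t / s <= t => [wl|].
  have [/wl//|/ltW ts] := leP s t => ? ? ? ?.
  by rewrite (distrC t) (distrC (f t)); exact: wl.
move=> cs sd ct td; rewrite ger0_norm ?subr_ge0// => tsr.
have := rP 1%N (fun=> s) (fun=> t); rewrite !big_ord1; apply=> //.
by apply/trivIsetP => i j _ _; rewrite !ord1 eqxx.
Qed.

Lemma abs_continuous_on_bounded f c d : c <= d -> abs_continuous_on c d f ->
  exists X, forall t, c <= t <= d -> `|f t| <= X.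
Proof.
move=> cd fac; have [r r0 rP] := abs_continuous_on_uniform fac ltr01.
pose Q s t := exists X, forall u, s <= u <= t -> `|f u| <= X.
apply: (interval_additive_ind (Q := Q)) =>
  // [s t u st tu [X XP] [Y YP]|T cT Td].
  exists (Num.max X Y) => v /andP[sv vu]; rewrite le_max.
  have [vt|tv] := leP v t; first by rewrite XP// sv.
  by rewrite [X in _ || X]YP ?orbT// vu ltW.
exists r => // s t cs sT Tt td Tsr tTr; exists (`|f T| + 1) => u /andP[su ut].
rewrite -lerBlDl; apply: le_trans (lerB_dist _ _) _; apply/ltW/rP; try lra.
by rewrite ltr_norml; lra.
Qed.

Lemma ae_derive_ge f c d L : c <= d -> abs_continuous_on c d f ->
  {ae @lebesgue_measure R, forall t, c <= t <= d ->
     exists2 l, is_derive t 1 f l & L <= l} ->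
  L * (d - c) <= f d - f c.
Proof.
move=> cd fac fL.
suff : (- f d) - (- f c) <= - L * (d - c) by lra.
apply: (ae_derive_le (f := fun t => - f t)) => //.
  exact: abs_continuous_onN.
apply: filterS fL => t /[apply] -[l fl Ll]; exists (- l); last by lra.
exact: is_deriveN.
Qed.

Lemma ae_derive_norm f c d L : c <= d -> abs_continuous_on c d f ->
  {ae @lebesgue_measure R, forall t, c <= t <= d ->
     exists2 l, is_derive t 1 f l & `|l| <= L} ->
  `|f d - f c| <= L * (d - c).
Proof.
move=> cd fac fL; rewrite ler_norml -mulNr; apply/andP; split.
  apply: ae_derive_ge => //; apply: filterS fL => t /[apply] -[l ? lL].
  by exists l => //; move: lL; rewrite ler_norml => /andP[].
apply: ae_derive_le => //; apply: filterS fL => t /[apply] -[l ? lL].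
by exists l => //; move: lL; rewrite ler_norml => /andP[].
Qed.

End AbsContinuous.

Section AbsContinuousSum.
Context {R : realType}.
Implicit Types (f g : R -> R) (c d k : R).

Lemma abs_continuous_on_cst c d k : abs_continuous_on c d (fun=> k).
Proof.
move=> e e0; exists 1 => // N u v _ _ _.
by rewrite big1 // => i _; rewrite subrr normr0.
Qed.

Lemma abs_continuous_onD f g c d : abs_continuous_on c d f ->
  abs_continuous_on c d g -> abs_continuous_on c d (fun t => f t + g t).
Proof.
move=> fac gac e e0; have e20 : 0 < e / 2 by rewrite divr_gt0.
have [r r0 rP] := fac _ e20; have [r' r'0 r'P] := gac _ e20.
exists (Num.min r r'); first by rewrite lt_min r0.
move=> N u v uv tI; rewrite lt_min =>
  /andP[/(rP _ _ _ uv tI) sf /(r'P _ _ _ uv tI) sg].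
have -> : e = e / 2 + e / 2 by lra.
apply: le_lt_trans (ltrD sf sg); rewrite -big_split; apply: ler_sum => i _ /=.
by rewrite opprD addrACA ler_normD.
Qed.

Lemma abs_continuous_onZ f c d k : abs_continuous_on c d f ->
  abs_continuous_on c d (fun t => f t * k).
Proof.
move=> fac e e0; have k0 : 0 < `|k| + 1 by rewrite ltr_wpDl.
have [r r0 rP] := fac _ (divr_gt0 e0 k0); exists r =>
  // N u v uv tI /(rP _ _ _ uv tI).
rewrite ltr_pdivlMr//; apply: le_lt_trans.
rewrite mulr_suml; apply: ler_sum => i _.
by rewrite -mulrBl normrM ler_wpM2l// lerDl.
Qed.

Lemma abs_continuous_on_sum (I : finType) (f : I -> R -> R) c d :
  (forall i, abs_continuous_on c d (f i)) ->
  abs_continuous_on c d (fun t => \sum_i f i t).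
Proof.
move=> fac; rewrite /index_enum; elim: (Finite.enum I) => [|i l IH].
  under eq_fun do rewrite big_nil.
  exact: abs_continuous_on_cst.
under eq_fun do rewrite big_cons.
exact: abs_continuous_onD (fac i) IH.
Qed.

End AbsContinuousSum.

(** * Cyclic sign changes *)

(** This counts the changes in [b :: s]; keeping the head apart makes the count additive under
    concatenation. *)
Fixpoint changes (b : bool) (s : seq bool) : nat :=
  if s is c :: s' then ((b != c) + changes c s')%N else 0%N.

Definition cyclic_changes (s : seq bool) : nat :=
  if s is b :: s' then changes b (rcons s' b) else 0%N.

Lemma changes_cat b s1 s2 :
  changes b (s1 ++ s2) = (changes b s1 + changes (last b s1) s2)%N.
Proof. by elim: s1 b => //= c s1 IH b; rewrite IH addnA. Qed.

Lemma changes_rcons b s c : changes b (rcons s c) = (changes b s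
  + (last b s != c))%N.
Proof. by rewrite -cats1 changes_cat /= addn0. Qed.

Lemma cyclic_changes_rcons b s : cyclic_changes (b :: s) =
  cyclic_changes (rcons s b).
Proof.
by case: s => //= c s; rewrite !changes_rcons last_rcons addnC.
Qed.

Lemma cyclic_changes_catC s1 s2 :
  cyclic_changes (s1 ++ s2) = cyclic_changes (s2 ++ s1).
Proof.
elim: s1 s2 => [s2|b s1 IH s2]; first by rewrite cats0.
by rewrite cat_cons cyclic_changes_rcons -cats1 -catA IH -catA.
Qed.

Lemma leq_changes_cyclic b s : (changes b s <= cyclic_changes (b :: s))%N.
Proof. by rewrite /= changes_rcons leq_addr. Qed.

(** Triangle inequality: two differing cyclic neighbours still differ across a sign inserted between
    them. *)
Lemma leq_cyclic_changes_cons b s : (cyclic_changes s <=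
  cyclic_changes (b :: s))%N.
Proof.
case: s => //= c s; rewrite !changes_rcons.
by case: b; case: c; case: (last _ s) => /=; lia.
Qed.

Lemma cyclic_changes_dup b s : cyclic_changes [:: b, b & s] =
  cyclic_changes (b :: s).
Proof. by rewrite /= eqxx. Qed.

Section Signs.
Context {R : realType}.
Implicit Types (l : seq R) (v w : R).

Definition neg_signs l : seq bool := [seq v < 0 | v <- l & v != 0].

Lemma neg_signs_cat l1 l2 : neg_signs (l1 ++ l2) = neg_signs l1 ++ neg_signs l2.
Proof. by rewrite /neg_signs filter_cat map_cat. Qed.

Lemma neg_signs_cons v l :
  neg_signs (v :: l) = if v != 0 then (v < 0) :: neg_signs l else neg_signs l.
Proof. by rewrite /neg_signs /=; case: ifP. Qed.

Lemma sigma_nil : sigma ([::] : seq R) = 0%N.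
Proof. by rewrite /sigma big_geq. Qed.

Lemma sigma_cons2 v w l : sigma [:: v, w & l] = ((v * w < 0)%R
  + sigma (w :: l))%N.
Proof. by rewrite /sigma /= big_nat_recl. Qed.

Lemma sigmaE v l : all (fun v => v != 0) (v :: l) ->
  sigma (v :: l) = changes (v < 0) [seq w < 0 | w <- l].
Proof.
elim: l v => [|w l IH] v; first by rewrite /sigma big_geq.
move=> /= /and3P[v0 w0 l0]; rewrite sigma_cons2 IH/= ?w0//; congr (_ + _)%N.
case: (ltrgt0P v) v0 => // v0 _; case: (ltrgt0P w) w0 => // w0 _ /=.
- by rewrite ltNge mulr_ge0 ?ltW.
- by rewrite pmulr_rlt0 ?w0.
- by rewrite nmulr_rlt0 ?w0.
- by rewrite nmulr_rlt0 // ltNge ltW.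
Qed.

Lemma s_minusE l :
  s_minus l = if neg_signs l is b :: s then changes b s else 0%N.
Proof.
rewrite /s_minus /neg_signs; have := filter_all (fun v => v != 0) l.
by case: [seq v <- l | v != 0] => [_|v l' /sigmaE ->] //; rewrite sigma_nil.
Qed.

End Signs.

Definition ring_from n (i : 'I_n) : seq 'I_n := rot i (enum 'I_n).

Definition ring_tail n (i : 'I_n) : seq 'I_n := behead (ring_from i).

Lemma ring_fromE n (i : 'I_n) : ring_from i = i :: ring_tail i.
Proof.
rewrite /ring_tail /ring_from /rot (drop_nth i) ?size_enum_ord//=.
by congr cons; apply: val_inj; rewrite /= nth_enum_ord.
Qed.

(** The two ends of [ring_tail i] are the cyclic neighbours of [i]; for [n = 1] the tail is
    empty. *)
Lemma ring_tail_ordS n (i : 'I_n) : (1 < n)%N ->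
  exists r, ring_tail i = ordS i :: r.
Proof.
move=> n1; rewrite /ring_tail /ring_from /rot (drop_nth i) ?size_enum_ord//=.
have [iSn|] := ltnP i.+1 n.
  rewrite (drop_nth i) ?size_enum_ord//=; eexists; congr cons.
  by apply: val_inj; rewrite /= nth_enum_ord//= modn_small.
move=> nSi; have iE : i.+1 = n by apply/eqP; rewrite eqn_leq ltn_ord.
rewrite drop_oversize ?size_enum_ord//=.
case def_s: (take i (enum 'I_n)) => [|j r].
  by move/(congr1 size): def_s; rewrite size_takel ?size_enum_ord /=; lia.
exists r; congr cons; apply: val_inj => /=.
have -> : j = nth i (take i (enum 'I_n)) 0 by rewrite def_s.
by rewrite nth_take ?nth_enum_ord /= ?iE ?modnn//; lia.
Qed.

Lemma ring_tail_ord_pred n (i : 'I_n) : (1 < n)%N ->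
  exists r, ring_tail i = rcons r (ord_pred i).
Proof.
move=> n1; rewrite /ring_tail /ring_from /rot (drop_nth i) ?size_enum_ord//=.
have [i0|i0] := posnP i.
  rewrite i0 take0 cats0; case/lastP def_s: (drop 1 (enum 'I_n)) => [|r j].
    by move/(congr1 size): def_s; rewrite size_drop size_enum_ord /=; lia.
  exists r; congr rcons; apply: val_inj => /=.
  have -> : j = last i (drop 1 (enum 'I_n)) by rewrite def_s last_rcons.
  rewrite -nth_last size_drop size_enum_ord nth_drop nth_enum_ord; last lia.
  by rewrite i0 add0n modn_small; lia.
have ie : (i.-1 < size (enum 'I_n))%N by rewrite size_enum_ord; case: i i0 =>
  /=; lia.
rewrite -{2}(prednK i0) (take_nth i) // -rcons_cat; eexists; congr rcons.
apply: val_inj; rewrite /= nth_enum_ord /=; last by case: i i0 ie => /=; lia.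
have -> : ((i + n).-1 = i.-1 + n)%N by lia.
by rewrite modnDr modn_small //; case: i i0 ie => /=; lia.
Qed.

Section CyclicSigns.
Context {R : realType} {n : nat}.
Implicit Types (x y : 'cV[R]_n) (i j : 'I_n).

Definition signs_along (r : seq 'I_n) y : seq bool :=
  neg_signs [seq y k 0 | k <- r].

Lemma signs_along_cat r1 r2 y :
  signs_along (r1 ++ r2) y = signs_along r1 y ++ signs_along r2 y.
Proof. by rewrite /signs_along map_cat neg_signs_cat. Qed.

Lemma signs_along_rcons r i y : signs_along (rcons r i) y =
  if y i 0 != 0 then rcons (signs_along r y) (y i 0 < 0) else signs_along r y.
Proof.
rewrite -cats1 signs_along_cat {2}/signs_along /neg_signs /=.
by case: ifP; rewrite ?cats1 ?cats0.
Qed.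

Lemma signs_along_cons r i y : signs_along (i :: r) y =
  if y i 0 != 0 then (y i 0 < 0) :: signs_along r y else signs_along r y.
Proof. exact: neg_signs_cons. Qed.

Lemma eq_signs_along r x y : (forall k, k \in r -> Num.sg (x k 0) =
  Num.sg (y k 0)) ->
  signs_along r x = signs_along r y.
Proof.
elim: r => [//|k r IH] xy; rewrite !signs_along_cons IH; last first.
  by move=> j jr; apply: xy; rewrite inE jr orbT.
have xyk : Num.sg (x k 0) = Num.sg (y k 0) by apply: xy; rewrite mem_head.
by rewrite -(sgr_lt0 (x k 0)) -(sgr_lt0 (y k 0)) -(sgr_eq0 (x k 0)) -(sgr_eq0
  (y k 0)) xyk.
Qed.

Lemma cyclic_changes_ring i y :
  cyclic_changes (signs_along (ring_from i) y) =
  cyclic_changes (signs_along (enum 'I_n) y).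
Proof.
rewrite /ring_from /rot signs_along_cat cyclic_changes_catC -signs_along_cat.
by rewrite cat_take_drop.
Qed.

Lemma ring_seqE y i : ring_seq y i = [seq y k 0 | k <- rcons (ring_from i) i].
Proof. by rewrite /ring_seq map_rcons /ring_from map_rot. Qed.

(** A ring sequence that starts at a nonzero entry counts every change around the ring, and one that
    starts at a zero can only miss the closing change. The cyclic count is invariant under rotation,
    so any base point [i] will do. *)
Lemma sc_minusE y i : sc_minus y = cyclic_changes (signs_along (ring_from i) y).
Proof.
rewrite cyclic_changes_ring; apply/eqP; rewrite eqn_leq; apply/andP; split.
  apply/bigmax_leqP => k _; rewrite s_minusE ring_seqE -/(signs_along _ y).
  rewrite -(cyclic_changes_ring k) signs_along_rcons ring_fromE
    signs_along_cons.
  case: (y k 0 != 0) => //=; case: (signs_along _ y) => [//|b s].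
  exact: leq_changes_cyclic.
have [y0|] := pselect (forall k, y k 0 = 0).
  have -> // : signs_along (enum 'I_n) y = [::].
  by elim: (enum _) => // k r IH; rewrite signs_along_cons y0 eqxx.
move=> /existsNP[k /eqP yk]; apply: leq_trans (leq_bigmax k).
rewrite s_minusE ring_seqE -/(signs_along _ y) -(cyclic_changes_ring k).
by rewrite signs_along_rcons ring_fromE signs_along_cons yk.
Qed.

Lemma eq_sc_minus x y : (forall k, Num.sg (x k 0) = Num.sg (y k 0)) ->
  sc_minus x = sc_minus y.
Proof.
move=> xy; have [i|n0] := pickP 'I_n.
  by rewrite !(sc_minusE _ i) (eq_signs_along (y := y)).
by rewrite /sc_minus !big1 // => i; have := n0 i.
Qed.

Lemma eq_off_ring_tail i x y : (forall k, k != i -> Num.sg (x k 0) =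
  Num.sg (y k 0)) ->
  signs_along (ring_tail i) x = signs_along (ring_tail i) y.
Proof.
move=> xy; apply: eq_signs_along => k kr; apply: xy.
have : uniq (ring_from i) by rewrite rot_uniq enum_uniq.
rewrite ring_fromE => /andP[it _]; apply: contraNneq it => ki;
  by rewrite -{1}ki.
Qed.

(** Zeroing a coordinate deletes at most one sign from the ring. *)
Lemma sc_minus_zero i x y : (forall k, k != i -> Num.sg (y k 0) =
  Num.sg (x k 0)) ->
  y i 0 = 0 -> (sc_minus y <= sc_minus x)%N.
Proof.
move=> yx yi; rewrite !(sc_minusE _ i) ring_fromE !signs_along_cons yi eqxx /=.
rewrite (eq_off_ring_tail yx); case: ifP => // _;
  exact: leq_cyclic_changes_cons.
Qed.

Lemma ring_adjacent_signs i j y : (1 < n)%N -> j = ordS i \/ j = ord_pred i ->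
  y j 0 != 0 -> let b := y j 0 < 0 in
  cyclic_changes (b :: signs_along (ring_tail i) y) =
  cyclic_changes (signs_along (ring_tail i) y).
Proof.
move=> n1 [->|->] yj b.
  have [r ->] := ring_tail_ordS i n1.
  by rewrite signs_along_cons yj cyclic_changes_dup.
have [r ->] := ring_tail_ord_pred i n1.
rewrite signs_along_rcons yj -/b -rcons_cons -!cyclic_changes_rcons.
exact: cyclic_changes_dup.
Qed.

(** The new sign at [i] duplicates an adjacent one, so the count is that of the ring without [i],
    which is at most the original count. With a single index [i = j] and no sign changes. *)
Lemma sc_minus_copy i j x y : j = ordS i \/ j = ord_pred i ->
  (forall k, k != i -> Num.sg (y k 0) = Num.sg (x k 0)) ->
  x j 0 != 0 -> Num.sg (y i 0) = Num.sg (x j 0) -> (sc_minus y <= sc_minus x)%N.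
Proof.
move=> ij yx xj yij; have [n1|n1] := ltnP 1 n; last first.
  rewrite (@eq_sc_minus y x)// => k; have [->|/yx//] := eqVneq k i.
  rewrite yij; congr (Num.sg (x _ _)); apply: val_inj.
  by case: i j {ij yx xj yij} => i ? [j ?] /=; lia.
rewrite !(sc_minusE _ i) ring_fromE !signs_along_cons (eq_off_ring_tail yx).
rewrite -(sgr_lt0 (y i 0)) -(sgr_eq0 (y i 0)) yij sgr_lt0 sgr_eq0 xj.
rewrite (ring_adjacent_signs n1 ij)//.
by case: ifP => // _; exact: leq_cyclic_changes_cons.
Qed.

(** The sign at [i] is kept, becomes zero, or becomes the sign of [x j 0]; these are the cases of
    [eq_sc_minus], [sc_minus_zero] and [sc_minus_copy]. *)
Lemma sc_minus_addmul i j (c : R) x y : j = ordS i \/ j = ord_pred i -> 0 <=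
  c ->
  (forall k, k != i -> y k 0 = x k 0) -> y i 0 = x i 0 + c * x j 0 ->
  (sc_minus y <= sc_minus x)%N.
Proof.
move=> ij c0 yx yi; have sgyx k : k != i -> Num.sg (y k 0) = Num.sg (x k 0).
  by move=> /yx->.
have [yx'|nyx] := eqVneq (Num.sg (y i 0)) (Num.sg (x i 0)).
  by rewrite (@eq_sc_minus y x)// => k; have [->//|/sgyx//] := eqVneq k i.
have [yi0|yi0] := eqVneq (y i 0) 0; first exact: (sc_minus_zero sgyx).
have yj : Num.sg (y i 0) = Num.sg (x j 0).
  move: yi0 nyx; rewrite yi; case: (ltrgt0P (x j 0)) => xj.
  - have cx : 0 <= c * x j 0 by rewrite mulr_ge0// ltW.
    case: (ltrgt0P (x i 0)) => xi.
    + by rewrite (gtr0_sg xi) gtr0_sg ?eqxx//; lra.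
    + by case: (ltrgt0P (x i 0 + _)) => // y0 _;
        rewrite ?(gtr0_sg y0) ?(ltr0_sg y0) (ltr0_sg xi) (gtr0_sg xj) ?eqxx.
    + by rewrite xi add0r => yn0 _; rewrite !gtr0_sg// lt0r yn0.
  - have cx : c * x j 0 <= 0 by rewrite mulr_ge0_le0// ltW.
    case: (ltrgt0P (x i 0)) => xi.
    + by case: (ltrgt0P (x i 0 + _)) => // y0 _;
        rewrite ?(gtr0_sg y0) ?(ltr0_sg y0) (gtr0_sg xi) (ltr0_sg xj) ?eqxx.
    + by rewrite (ltr0_sg xi) ltr0_sg ?eqxx//; lra.
    + by rewrite xi add0r => yn0 _; rewrite !ltr0_sg// lt_neqAle yn0.
  - by rewrite xj mulr0 addr0 eqxx.
apply: (sc_minus_copy ij sgyx) => //; apply: contraNneq yi0 => xj.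
by rewrite -sgr_eq0 yj xj sgr0.
Qed.

End CyclicSigns.

(** * Stability of cyclic sign variations under perturbation *)

Section SignPerturbation.
Context {R : realType} {n : nat}.
Implicit Types (x y w : 'cV[R]_n) (i j k : 'I_n).

(** The coordinates of [x] are replaced by those of [y] one at a time; [z] and [z'] are consecutive
    mixtures. *)
Lemma sc_minus_le_interp x y :
  (forall (z z' : 'cV[R]_n) i, (forall k, k != i -> z' k 0 = z k 0) ->
     (forall k, z k 0 = x k 0 \/ z k 0 = y k 0) ->
     z i 0 = x i 0 -> z' i 0 = y i 0 -> (sc_minus z' <= sc_minus z)%N) ->
  (sc_minus y <= sc_minus x)%N.
Proof.
move=> step.
pose z (r : seq 'I_n) : 'cV[R]_n := \col_k if k \in r then y k 0 else x k 0.
have zle r : uniq r -> (sc_minus (z r) <= sc_minus x)%N.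
  elim: r => [_|i r IH /= /andP[ir /IH zr]].
    by rewrite (_ : z [::] = x)//; apply/colP => k; rewrite mxE.
  apply: leq_trans zr; apply: (step _ _ i) => [k ki|k||].
  - by rewrite !mxE inE (negPf ki).
  - by rewrite !mxE; case: ifP; [right | left].
  - by rewrite mxE (negPf ir).
  - by rewrite mxE mem_head.
have := zle _ (enum_uniq 'I_n); rewrite (_ : z _ = y)//.
by apply/colP => k; rewrite mxE mem_enum.
Qed.

(** Lower semicontinuity of s_c^-: passing from [y] to [x] only turns some coordinates into zeros,
    up to signs. *)
Lemma sc_minus_le_of_signs x y :
  (forall k, x k 0 != 0 -> Num.sg (y k 0) = Num.sg (x k 0)) ->
  (sc_minus x <= sc_minus y)%N.
Proof.
move=> xy; apply: sc_minus_le_interp => z z' i zz' _ zi zi'.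
have sgzz' k : k != i -> Num.sg (z' k 0) = Num.sg (z k 0) by move=> /zz'->.
have [xi|xi] := eqVneq (x i 0) 0.
  by apply: (sc_minus_zero sgzz'); rewrite zi'.
rewrite (eq_sc_minus (y := z))// => k.
by have [->|/sgzz'//] := eqVneq k i; rewrite zi' zi xy.
Qed.

Definition isolated_zeros x : Prop :=
  forall i, x i 0 = 0 -> x (ordS i) 0 * x (ord_pred i) 0 < 0.

(** The neighbours of a zero of [x] have opposite signs, so any nonzero value put there has the sign
    of one of them and [sc_minus_copy] applies. *)
Lemma isolated_zeros_sc_minus_ge x y : isolated_zeros x ->
  (forall k, x k 0 != 0 -> Num.sg (y k 0) = Num.sg (x k 0)) ->
  (sc_minus y <= sc_minus x)%N.
Proof.
move=> regx xy; apply: sc_minus_le_interp => z z' i zz' zxy zi zi'.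
have sgzz' k : k != i -> Num.sg (z' k 0) = Num.sg (z k 0) by move=> /zz'->.
have sgzx k : x k 0 != 0 -> Num.sg (z k 0) = Num.sg (x k 0).
  by case: (zxy k) => -> // /xy.
have [/regx xi|xi] := eqVneq (x i 0) 0; last first.
  rewrite (eq_sc_minus (y := z))// => k.
  by have [->|/sgzz'//] := eqVneq k i; rewrite zi' zi xy.
have [z'i|z'i] := eqVneq (z' i 0) 0; first exact: (sc_minus_zero sgzz').
have [j [ij xj sgz'i]] : exists j, [/\ j = ordS i \/ j = ord_pred i,
    x j 0 != 0 & Num.sg (z' i 0) = Num.sg (x j 0)].
  have S0 : x (ordS i) 0 != 0 by apply: contraTneq xi => ->; rewrite mul0r ltxx.
  have P0 : x (ord_pred i) 0 != 0 by apply: contraTneq xi => ->;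
    rewrite mulr0 ltxx.
  have [e|e] := eqVneq (Num.sg (z' i 0)) (Num.sg (x (ordS i) 0)).
    by exists (ordS i); split=> //; left.
  exists (ord_pred i); split=> //; first by right.
  move: xi e S0 P0 z'i; case: sgrP => //; case: (sgrP (x (ordS i) 0)) => //;
    case: (sgrP (x (ord_pred i) 0)) => // *; nra.
apply: (sc_minus_copy ij sgzz'); last by rewrite sgzx.
by rewrite -sgr_eq0 sgzx// sgr_eq0.
Qed.

Lemma nonzero_entries_gap x : exists2 e : R, 0 < e &
  forall y, (forall k, `|y k 0 - x k 0| < e) ->
    forall k, x k 0 != 0 -> Num.sg (y k 0) = Num.sg (x k 0).
Proof.
(* The base value [1] keeps the minimum positive when every entry is zero. *)
exists (\big[Num.min/1]_(k | x k 0 != 0) `|x k 0|).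
  by apply: lt_bigmin => // k xk; rewrite normr_gt0.
move=> y yx k xk.
have {yx} : `|y k 0 - x k 0| < `|x k 0|.
  by apply: lt_le_trans (yx k) _; exact: bigmin_le_cond.
move: xk; case: (ltrgt0P (x k 0)) => // xk _; rewrite ltr_norml => /andP[? ?].
  by rewrite !gtr0_sg//; lra.
by rewrite !ltr0_sg//; lra.
Qed.

Lemma zero_fillingsP (l z : seq R) : z \in zero_fillings l ->
  size z = size l /\ forall m, (m < size l)%N ->
    z`_m != 0 /\ (l`_m != 0 -> z`_m = l`_m).
Proof.
elim: l z => [|v l IH] z; first by rewrite inE => /eqP->.
move=> /= /allpairsP[[w z'] /= [wv /IH[sz' z'P] ->]]; split; first
  by rewrite /= sz'.
move=> [_|m /= /z'P //]; move: wv; have [->|v0] := eqVneq v 0; rewrite !inE.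
  by move=> /orP[] /eqP->; rewrite ?oppr_eq0 oner_eq0; split.
by move=> /eqP->.
Qed.

(** Equality of the two end values makes a filling of the [n + 1] entries the ring sequence of a
    single vector [w], whose sign changes are then bounded by [sc_minus w]. *)
Lemma sc_plus_le y (m : nat) :
  (forall w, (forall k, w k 0 != 0) -> (forall k, y k 0 != 0 -> w k 0 =
    y k 0) ->
     (sc_minus w <= m)%N) ->
  (sc_plus y <= m)%N.
Proof.
move=> ym; apply/bigmax_leqP => i _; apply/bigmax_leqP_seq => z zy hlz.
rewrite ring_seqE in zy; have [sz zP] := zero_fillingsP zy.
rewrite size_map size_rcons in sz zP.
have urf : uniq (ring_from i) by rewrite rot_uniq enum_uniq.
have mrf k : k \in ring_from i by rewrite mem_rot mem_enum.
pose w : 'cV[R]_n := \col_k z`_(index k (ring_from i)).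
have ltk k : (index k (ring_from i) < (size (ring_from i)).+1)%N.
  by rewrite ltnS ltnW// index_mem.
have w0 k : w k 0 != 0 by rewrite mxE; have [] := zP _ (ltk k).
have zE : z = ring_seq w i.
  rewrite ring_seqE; apply: (@eq_from_nth _ 0);
    rewrite ?size_map ?size_rcons// => k kz.
  rewrite sz ltnS in kz; rewrite (nth_map i) ?size_rcons// mxE nth_rcons.
  case: (ltngtP k (size (ring_from i))) kz => [kr _|//|-> _]; first
    by rewrite index_uniq.
  have <- : last 0 z = z`_(size (ring_from i)) by rewrite -nth_last sz.
  by rewrite -(eqP hlz) -nth0 ring_fromE /= eqxx.
apply: leq_trans (ym w w0 _); last first.
  move=> k yk; have [_] := zP _ (ltk k).
  by rewrite (nth_map i) ?size_rcons// nth_rcons index_mem mrf nth_index// mxE;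
    apply.
apply: leq_trans (leq_bigmax i); rewrite -zE /s_minus.
suff /all_filterP -> : all (fun v => v != 0) z by [].
by rewrite zE ring_seqE all_map; apply/allP => k _ /=.
Qed.

End SignPerturbation.

(** * One Euler step *)

(** The two bounds are the extreme values of a linear form on the box between [m] and [M];
    intermediate values are attained on the segment joining the two extremal corners. *)
Lemma sum_interp (R : realFieldType) (I : finType) (m M x : I -> R) (w : R) :
  (forall j, m j <= M j) ->
  \sum_j (if 0 <= x j then m j else M j) * x j <= w ->
  w <= \sum_j (if 0 <= x j then M j else m j) * x j ->
  exists2 c : I -> R, (forall j, m j <= c j <= M j) & \sum_j c j * x j = w.
Proof.
move=> mM; set p := fun j => if 0 <= x j then m j else M j.
set q := fun j => if 0 <= x j then M j else m j.
set lo := \sum_j _; set hi := \sum_j _ => low whi.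
have [hilo|lohi] := leP hi lo.
  exists p; last by apply/le_anti; rewrite low (le_trans whi).
  by move=> j; rewrite /p; case: ifP; rewrite ?lexx ?mM.
pose th := (w - lo) / (hi - lo).
have th0 : 0 <= th by rewrite divr_ge0// subr_ge0 // ltW.
have th1 : th <= 1 by rewrite ler_pdivrMr ?subr_gt0// mul1r lerB.
have thE : th * (hi - lo) = w - lo by rewrite divfK// gt_eqF// subr_gt0.
exists (fun j => p j + th * (q j - p j)).
  by move=> j; have := mM j; rewrite /p /q; case: ifP => _ mMj; nra.
have -> : \sum_j (p j + th * (q j - p j)) * x j = lo + th * (hi - lo).
  rewrite /lo /hi -sumrB mulr_sumr -big_split; apply: eq_bigr => j _ /=.
  by rewrite /p /q; case: ifP => _; ring.
by rewrite thE; lra.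
Qed.

Lemma sum_coef_bounds (R : realFieldType) (I : finType) (m M x c : I -> R) :
  (forall j, m j <= c j <= M j) ->
  \sum_j (if 0 <= x j then m j else M j) * x j <= \sum_j c j * x j
    <= \sum_j (if 0 <= x j then M j else m j) * x j.
Proof.
move=> mcM; apply/andP; split; apply: ler_sum => j _;
  by have /andP[? ?] := mcM j; case: (leP 0 (x j)) => ?; nra.
Qed.

Lemma cyclic_bandP n (i j : 'I_n) : cyclic_band i j ->
  [\/ i = j, j = ordS i | j = ord_pred i].
Proof.
move=> /or4P[/eqP->|/eqP ji|/eqP ij|]; first by constructor.
- by constructor 2; apply: val_inj; rewrite /= -ji modn_small.
- constructor 3; apply: val_inj => /=; rewrite ij addSn /= modnDr modn_small//.
- move=> /orP[/andP[/eqP i0 /eqP jn]|/andP[/eqP iN /eqP j0]].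
    constructor 3; apply: val_inj => /=; rewrite i0 add0n jn modn_small//.
    by case: i {i0 jn} => /=; case: n {j} => //=.
  constructor 2; apply: val_inj; rewrite /= iN j0 prednK ?modnn//.
  exact: leq_trans (ltn_ord i).
Qed.

Definition cyclic_flow (R : realType) n (M : R) (A : R -> 'M[R]_n) (c d : R)
    (x : R -> 'cV[R]_n) : Prop :=
  (forall i, abs_continuous_on c d (fun t => x t i 0)) /\
  {ae @lebesgue_measure R, forall t, c <= t <= d ->
    [/\ in_Qplus (A t), (forall i j, `|A t i j| <= M)
      & forall i, is_derive t 1 (fun s => x s i 0) ((A t *m x t) i 0)]}.

Definition cyclic_coefs (R : realType) n (M : R) (C : 'I_n -> 'I_n ->
  R) : Prop :=
  [/\ forall i j, `|C i j| <= M, forall i j, i != j -> 0 <= C i j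
    & forall i j, ~~ cyclic_band i j -> C i j = 0].

Section CyclicFlow.
Context {R : realType} {n : nat} {M : R} {A : R -> 'M[R]_n}.
Implicit Types (c d s t h X : R) (x : R -> 'cV[R]_n).

Local Notation flow := (cyclic_flow M A).

Lemma cyclic_flowS c d c' d' x : c <= c' -> d' <= d -> flow c d x ->
  flow c' d' x.
Proof.
move=> cc dd [xac xae]; split; first by move=> i;
  exact: abs_continuous_onS (xac i).
by apply: filterS xae => t xt /andP[ct td]; apply: xt; lra.
Qed.

Lemma cyclic_flow_bounded c d x : c <= d -> flow c d x ->
  exists2 X, 0 <= X & forall t, c <= t <= d -> forall i, `|x t i 0| <= X.
Proof.
move=> cd [xac _].
have /choice[X XP] i := abs_continuous_on_bounded cd (xac i).
exists (\sum_i `|X i|); first by apply: sumr_ge0 => i _.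
move=> t ctd i; apply: (le_trans (XP i t ctd)); apply: (le_trans (ler_norm _)).
by rewrite (bigD1 i)//= lerDl sumr_ge0.
Qed.

Lemma mulmx_norm_le (B : 'M[R]_n) (v : 'cV[R]_n) X i :
  (forall i j, `|B i j| <= M) -> (forall j, `|v j 0| <= X) ->
  `|(B *m v) i 0| <= n%:R * (M * X).
Proof.
move=> BM vX; rewrite mxE; apply: le_trans (ler_norm_sum _ _ _) _.
rewrite mulr_natl -[X in _ *+ X]card_ord -sumr_const; apply: ler_sum => j _.
by rewrite normrM ler_pM.
Qed.

Lemma cyclic_flow_lipschitz c d X x : c <= d -> flow c d x ->
  (forall t, c <= t <= d -> forall i, `|x t i 0| <= X) ->
  forall i, `|x d i 0 - x c i 0| <= n%:R * (M * X) * (d - c).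
Proof.
move=> cd [xac xae] xX i; apply: (ae_derive_norm (f := fun t => x t i 0)) => //.
apply: filterS xae => t /[swap] ctd /(_ ctd)[_ AM /(_ i) xt].
by exists ((A t *m x t) i 0) => //; apply: mulmx_norm_le => //; exact: xX.
Qed.

(** [C] plays the part of the time average of [A], row by row: the mean slope of coordinate [i] is
    nearly a value of the linear form of [x c] on the box of admissible rows, and [sum_interp]
    yields a row attaining a nearby value. *)
Lemma cyclic_flow_euler c d X x : 0 <= M -> c <= d -> flow c d x ->
  (forall t, c <= t <= d -> forall i, `|x t i 0| <= X) ->
  exists2 C, cyclic_coefs M C & forall i,
    `|x d i 0 - x c i 0 - (d - c) * \sum_j C i j * x c j 0|
      <= n%:R * (M * (n%:R * (M * X))) * (d - c) ^+ 2.
Proof.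
move=> M0 cd xf xX; set e := n%:R * (M * (n%:R * (M * X))).
have [dc|] := eqVneq d c.
  exists (fun _ _ => 0) => [|i].
    by split => // i j; rewrite normr0.
  by rewrite dc !subrr mul0r expr0n mulr0 subrr normr0.
rewrite neq_lt ltNge cd /= => cltd.
(* The box of admissible rows: [[-M, M]] on the diagonal, [[0, M]] elsewhere in the band, zero
   outside it. *)
pose m (i j : 'I_n) : R := if i == j then - M else 0.
pose N (i j : 'I_n) : R := if cyclic_band i j then M else 0.
have mN i j : m i j <= N i j.
  by rewrite /m /N /cyclic_band; case: eqVneq => //= _;
    [by apply: (le_trans _ M0); rewrite oppr_le0 | case: ifP].
suff /choice[C CP] : forall i, exists C : 'I_n -> R,
    (forall j, m i j <= C j <= N i j) /\
    `|x d i 0 - x c i 0 - (d - c) * \sum_j C j * x c j 0| <= e * (d - c) ^+ 2.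
  exists C => [|i]; last exact: (CP i).2.
  split=> i j.
  - have [/(_ j) + _] := CP i; rewrite /m /N ler_norml.
    by case: ifP => _; case: ifP => _ /andP[? ?]; lra.
  - by move=> ij; have [/(_ j) + _] := CP i; rewrite /m (negPf ij) => /andP[].
  - move=> nij; have [/(_ j) + _] := CP i; rewrite /m /N (negPf nij).
    case: eqP => [ij|_ /andP[? ?]]; last by lra.
    by move: nij; rewrite ij /cyclic_band eqxx.
move=> i; have [xac xae] := xf.
set lo := \sum_j (if 0 <= x c j 0 then m i j else N i j) * x c j 0.
set hi := \sum_j (if 0 <= x c j 0 then N i j else m i j) * x c j 0.
have xi' : {ae @lebesgue_measure R, forall t, c <= t <= d ->
     exists2 l, is_derive t 1 (fun t => x t i 0) l &
       lo - e * (d - c) <= l <= hi + e * (d - c)}.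
  apply: filterS xae => t /[swap] ctd /(_ ctd)[[Am _ Ab] AM /(_ i) xt].
  exists ((A t *m x t) i 0) => //.
  (* Freezing the state at time [c] costs [e * (d - c)], by the Lipschitz bound. *)
  have -> : A t *m x t = A t *m x c + A t *m (x t - x c)
    by rewrite -mulmxDr addrC subrK.
  have /ler_normlP[? ?] : `|(A t *m (x t - x c)) i 0| <= e * (d - c).
    have -> : e * (d - c) = n%:R * (M * (n%:R * (M * X) * (d - c)))
      by rewrite /e; ring.
    apply: mulmx_norm_le => // j; rewrite !mxE.
    have /andP[ct td] := ctd.
    apply: (le_trans (cyclic_flow_lipschitz ct (cyclic_flowS (lexx c) td xf) _
      j)).
      by move=> u /andP[cu ut]; apply: xX; lra.
    apply: ler_wpM2l; last lra.
    by rewrite !mulr_ge0// (le_trans _ (xX c _ i))//; lra.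
  have /andP[? ?] : lo <= (A t *m x c) i 0 <= hi.
    rewrite mxE; apply: sum_coef_bounds => j; rewrite /m /N.
    have := AM i j; rewrite ler_norml => /andP[? ?].
    have [ij|ij] := eqVneq i j.
      by have -> : cyclic_band i j; [rewrite ij /cyclic_band eqxx | lra].
    rewrite Am//=; case: ifP => // nb.
    by have [->//|/Ab] := eqVneq (A t i j) 0; rewrite nb.
  rewrite [X in _ <= X <= _]mxE; lra.
have up : x d i 0 - x c i 0 <= (hi + e * (d - c)) * (d - c).
  apply: (ae_derive_le (f := fun t => x t i 0)) => //.
  by apply: filterS xi' => t /[apply] -[l ? /andP[? ?]]; exists l.
have dn : (lo - e * (d - c)) * (d - c) <= x d i 0 - x c i 0.
  apply: (ae_derive_ge (f := fun t => x t i 0)) => //.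
  by apply: filterS xi' => t /[apply] -[l ? /andP[? ?]]; exists l.
have lohi : lo <= hi.
  have /andP[] : lo <= \sum_j m i j * x c j 0 <= hi.
    by apply: sum_coef_bounds => j; rewrite lexx mN.
  exact: le_trans.
(* The mean slope is clipped to [[lo, hi]], which moves it by at most [e * (d - c)]. *)
pose w := Num.max lo (Num.min hi ((x d i 0 - x c i 0) / (d - c))).
have [||C CP wE] := @sum_interp R _ (m i) (N i) (fun j => x c j 0) w (mN i).
- by rewrite -/lo /w le_max lexx.
- by rewrite -/hi /w ge_max lohi ge_min lexx.
exists C; split=> //; rewrite wE expr2 ler_norml.
have xE : x d i 0 - x c i 0 = (d - c) * ((x d i 0 - x c i 0) / (d - c)).
  by rewrite mulrC divfK// subr_eq0 gt_eqF.
move: up dn; rewrite /w; set D := _ / (d - c) in xE *; rewrite {}xE => up dn.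
have upD : D <= hi + e * (d - c) by nra.
have dnD : lo - e * (d - c) <= D by nra.
have X0 : 0 <= X by apply: le_trans (xX c _ i); rewrite ?lexx.
have e0 : 0 <= e * (d - c) by rewrite mulr_ge0 ?subr_ge0// /e !mulr_ge0.
have /andP[lw wu] : - (e * (d - c)) <= D - Num.max lo (Num.min hi D) <=
  e * (d - c).
  by rewrite /Num.max /Num.min; case: (ltP hi D) => ?; case: ltP => ?; lra.
rewrite -mulrBr; set W := D - _ in lw wu *.
have -> : e * ((d - c) * (d - c)) = (d - c) * (e * (d - c)) by ring.
by rewrite -mulrN; apply/andP; split; rewrite ler_wpM2l ?subr_ge0.
Qed.

End CyclicFlow.

(** * Sign changes along the flow *)

Section ElementarySteps.
Context {R : realType} {n : nat}.
Implicit Types (u v w : 'cV[R]_n) (C : 'I_n -> 'I_n -> R) (h M B : R).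

(* Splitting [1 + h C] into the factors [1 + h C_ij E_ij]: it costs O(h^2), and
   each factor modifies a single coordinate. *)
Definition elem_step h C (p : 'I_n * 'I_n) v : 'cV[R]_n :=
  v + (h * C p.1 p.2 * v p.2 0) *: delta_mx p.1 0.

Definition elem_steps h C (l : seq ('I_n * 'I_n)) v : 'cV[R]_n :=
  foldr (elem_step h C) v l.

Lemma elem_stepE h C p v k : elem_step h C p v k 0 =
  v k 0 + (if k == p.1 then h * C p.1 p.2 * v p.2 0 else 0).
Proof.
by rewrite !mxE eqxx andbT; case: eqP => _; rewrite ?mulr1 ?mulr0.
Qed.

Lemma elem_stepsB h C l u v :
  elem_steps h C l (u - v) = elem_steps h C l u - elem_steps h C l v.
Proof.
elim: l => [//|p l /= ->]; apply/colP => k; rewrite !(elem_stepE, mxE).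
by case: ifP => _; ring.
Qed.

(** The two estimates go through the induction together: a new factor reads coordinate [b] after the
    earlier factors have acted, and the first-order bound on that coordinate gives the second-order
    error. *)
Lemma elem_steps_approx M (l : seq ('I_n * 'I_n)) : 0 <= M ->
  exists2 K : R, 0 <= K & forall h C v B, 0 <= h <= 1 ->
    (forall i j, `|C i j| <= M) -> (forall k, `|v k 0| <= B) ->
    forall i, `|elem_steps h C l v i 0 - v i 0| <= K * h * B /\
      `|elem_steps h C l v i 0 - v i 0
         - h * \sum_(p <- l | p.1 == i) C p.1 p.2 * v p.2 0| <= K * h ^+ 2 * B.
Proof.
move=> M0; elim: l => [|[a b] l [K K0 IH]].
  exists 0 => // h C v B _ _ _ i; rewrite big_nil mulr0 subr0 /= subrr normr0.
  by rewrite !mul0r.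
(* [M] accounts for the new term evaluated at [v], and [M * K] for the drift of coordinate [b]. *)
exists (K + M + M * K); first by rewrite !addr_ge0// mulr_ge0.
move=> h C v B h01 CM vB i; have [IH1 IH2] := IH h C v B h01 CM vB i.
have [IHb _] := IH h C v B h01 CM vB b.
have /andP[h0 h1] := h01.
have B0 : 0 <= B by apply: le_trans (vB i).
rewrite /= elem_stepE big_cons /=; set z := elem_steps h C l v.
rewrite -/z in IH1 IH2 IHb; rewrite [a == i]eq_sym.
set S := \sum_(_ <- l | _) _ in IH2 *.
have CMab := CM a b; have vBb := vB b.
have KhB : 0 <= K * h * B by rewrite !mulr_ge0.
have KhhB : 0 <= K * h ^+ 2 * B by rewrite !mulr_ge0// exprn_ge0.
have MhB : 0 <= M * h * B by rewrite !mulr_ge0.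
have MhhB : 0 <= M * h ^+ 2 * B by rewrite !mulr_ge0// exprn_ge0.
have MKhB : 0 <= M * K * h * B by rewrite !mulr_ge0.
have MKhhB : 0 <= M * K * h ^+ 2 * B by rewrite !mulr_ge0// exprn_ge0.
have MKle : M * K * h ^+ 2 * B <= M * K * h * B.
  by rewrite ler_wpM2r// ler_wpM2l ?mulr_ge0// expr2 ler_piMr.
have zb : `|h * C a b * (z b 0 - v b 0)| <= M * K * h ^+ 2 * B.
  rewrite !normrM (ger0_norm h0).
  have -> : M * K * h ^+ 2 * B = h * M * (K * h * B) by ring.
  by rewrite ler_pM ?mulr_ge0// ler_wpM2l.
have vb : `|h * C a b * v b 0| <= M * h * B.
  rewrite !normrM (ger0_norm h0) [M * h]mulrC.
  by rewrite ler_pM ?mulr_ge0// ler_wpM2l.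
have zE : h * C a b * z b 0 = h * C a b * (z b 0 - v b 0) + h * C a b * v b 0
  by ring.
case: ifP => _; last by rewrite addr0; split;
  [apply: (le_trans IH1) | apply: (le_trans IH2)]; nra.
split.
  have -> : z i 0 + h * C a b * z b 0 - v i 0 = z i 0 - v i 0
    + (h * C a b * (z b 0 - v b 0) + h * C a b * v b 0) by rewrite zE; ring.
  apply: le_trans (ler_normD _ _) _;
    have := ler_normD (h * C a b * (z b 0 - v b 0)) (h * C a b * v b 0).
  lra.
have -> : z i 0 + h * C a b * z b 0 - v i 0 - h * (C a b * v b 0 + S) =
  (z i 0 - v i 0 - h * S) + h * C a b * (z b 0 - v b 0) by ring.
by apply: le_trans (ler_normD _ _) _; lra.
Qed.

Lemma sum_row_pairs C v i :
  \sum_(p <- enum {: 'I_n * 'I_n} | p.1 == i) C p.1 p.2 * v p.2 0 =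
  \sum_j C i j * v j 0.
Proof.
rewrite big_enum_cond (eq_bigl (fun p => pred1 i p.1 && true)) => [|p];
  last first.
  by rewrite /= andbT.
rewrite -(pair_big_dep (pred1 i) (fun _ _ => true) (fun i j =>
  C i j * v j 0)) /=.
exact: big_pred1_eq.
Qed.

(** A diagonal factor multiplies one coordinate by [1 + h * C i i], positive because [h * M < 1]; a
    factor off the diagonal in the band falls under [sc_minus_addmul]; one outside the band is the
    identity. *)
Lemma sc_minus_elem_steps M h C l v : cyclic_coefs M C -> 0 <= h -> h * M < 1 ->
  (sc_minus (elem_steps h C l v) <= sc_minus v)%N.
Proof.
move=> [CM C0 Cband] h0 hM; elim: l => [//|[i j] l IH] /=.
apply: leq_trans IH; set z := elem_steps h C l v.
have off k : k != i -> elem_step h C (i, j) z k 0 = z k 0.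
  by rewrite elem_stepE /= => /negPf ->; rewrite addr0.
have at_i : elem_step h C (i, j) z i 0 = z i 0 + h * C i j * z j 0.
  by rewrite elem_stepE eqxx.
have [ij|ij] := eqVneq i j.
  rewrite (@eq_sc_minus _ _ _ z)// => k; have [->|/off->//] := eqVneq k i.
  rewrite at_i -ij; have -> : z i 0 + h * C i i * z i 0 = (1
    + h * C i i) * z i 0 by ring.
  rewrite sgrM gtr0_sg ?mul1r//; have := CM i i; rewrite ler_norml =>
    /andP[? ?]; nra.
have [/cyclic_bandP[/eqP|jS|jP]|/Cband Cij] := boolP (cyclic_band i j).
- by rewrite (negPf ij).
- by apply: sc_minus_addmul off at_i; [left | rewrite mulr_ge0// C0].
- by apply: sc_minus_addmul off at_i; [right | rewrite mulr_ge0// C0].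
- rewrite (@eq_sc_minus _ _ _ z)// => k; have [->|/off->//] := eqVneq k i.
  by rewrite at_i Cij mulr0 mul0r addr0.
Qed.

End ElementarySteps.

(** * Limit of the Euler scheme, and backward uniqueness *)

Section CyclicFlowVD.
Context {R : realType} {n : nat} {M : R} {A : R -> 'M[R]_n}.
Implicit Types (c d s t h X : R) (x : R -> 'cV[R]_n).

Local Notation flow := (cyclic_flow M A).

(** [y] is the result of [N] rounds of elementary steps of size [h = (d - c) / N]. Each round adds
    an error of order [h ^+ 2], and a discrete Gronwall estimate bounds the total by a multiple of
    [1 / N]. *)
Lemma cyclic_flow_sc_minus_approx c d x : 0 <= M -> c <= d -> flow c d x ->
  exists2 K : R, 0 <= K & forall N : nat, (0 < N)%N -> d - c <= N%:R ->
    (d - c) * M < N%:R ->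
    exists2 y : 'cV[R]_n, (sc_minus y <= sc_minus (x c))%N &
      forall i, `|x d i 0 - y i 0| <= K / N%:R.
Proof.
move=> M0 cd xf; have [X X0 xX] := cyclic_flow_bounded cd xf.
have [K K0 KP] := elem_steps_approx (enum {: 'I_n * 'I_n}) M0.
(* [K1 * h ^+ 2] is the error of one round: the Euler remainder plus the cost of splitting
   [1 + h C]. *)
pose K1 := n%:R * (M * (n%:R * (M * X))) + K * X.
have K10 : 0 <= K1 by rewrite addr_ge0 ?mulr_ge0.
exists (K1 * (d - c) ^+ 2 * expR (K * (d - c))).
  by rewrite !mulr_ge0 ?expR_ge0 ?exprn_ge0 ?subr_ge0.
move=> N N0 dcN dcMN; pose h := (d - c) / N%:R.
have NR : 0 < N%:R :> R by rewrite ltr0n.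
have h0 : 0 <= h by rewrite divr_ge0 ?subr_ge0// ltW.
have h1 : h <= 1 by rewrite ler_pdivrMr// mul1r.
have hM : h * M < 1 by rewrite mulrAC ltr_pdivrMr// mul1r.
have hN : h * N%:R = d - c by rewrite divfK// gt_eqF.
have main k : (k <= N)%N -> exists2 y : 'cV[R]_n,
    (sc_minus y <= sc_minus (x c))%N &
    forall i, `|x (c + k%:R * h) i 0 - y i 0| <= K1 * h ^+ 2 * (k%:R * (1
      + K * h) ^+ k).
  elim: k => [_|k IH kN].
    by exists (x c) => // i; rewrite mul0r addr0 subrr normr0 mul0r mulr0.
  have [y yc yx] := IH (ltnW kN).
  set s := c + k%:R * h in yx *; have cs : c <= s by rewrite lerDl mulr_ge0.
  have sE : c + k.+1%:R * h = s + h by rewrite /s -natr1; ring.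
  have sd : s + h <= d.
    rewrite -sE -lerBrDl -hN mulrC ler_wpM2l// ler_nat//.
  have ss : s <= s + h by rewrite lerDl.
  have [|C Ccoef CP] := cyclic_flow_euler M0 ss (cyclic_flowS cs sd xf) (X :=
    X).
    by move=> t /andP[st ts]; apply: xX; lra.
  rewrite (addrC s h) addrK (addrC h s) in CP.
  exists (elem_steps h C (enum {: 'I_n * 'I_n}) y).
    by apply: leq_trans yc; exact: sc_minus_elem_steps Ccoef h0 hM.
  move=> i; rewrite sE; have [CM _ _] := Ccoef.
  have h01 : 0 <= h <= 1 by rewrite h0.
  have [|_] := KP h C (x s) X h01 CM _ i; first by apply: xX; lra.
  have [|] := KP h C (x s - y) (K1 * h ^+ 2 * (k%:R * (1
    + K * h) ^+ k)) h01 CM _ i.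
    by move=> j; rewrite !mxE.
  rewrite elem_stepsB; have := CP i; have := yx i.
  rewrite !sum_row_pairs; set B := K1 * h ^+ 2 * _ ; set S := h * _.
  set p := elem_steps h C _ (x s); set q := elem_steps h C _ y.
  rewrite !mxE => yxi e1 e2 _ e3.
  (* The summands are the Euler remainder, the splitting error, the change made by the round in the
     earlier error (by linearity of the steps), and that earlier error itself. *)
  have -> : x (s + h) i 0 - q i 0 = (x (s + h) i 0 - x s i 0 - S)
    - (p i 0 - x s i 0 - S) + ((p i 0 - q i 0) - (x s i 0 - y i 0))
      + (x s i 0 - y i 0) by ring.
  have Bk : B + K * h * B + K1 * h ^+ 2 <=
      K1 * h ^+ 2 * (k.+1%:R * (1 + K * h) ^+ k.+1).
    have -> : B + K * h * B + K1 * h ^+ 2 = K1 * h ^+ 2 * (k%:R * (1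
      + K * h) ^+ k.+1 + 1).
      by rewrite /B (exprS _ k); move: (_ ^+ k) => P; ring.
    apply: ler_wpM2l; first by rewrite mulr_ge0 ?exprn_ge0.
    rewrite -natr1 mulrDl mul1r lerD2l.
    by apply: exprn_ege1; rewrite lerDl mulr_ge0.
  have K1E : K1 * h ^+ 2 = n%:R * (M * (n%:R * (M * X))) * h ^+ 2
    + K * h ^+ 2 * X.
    by rewrite /K1; ring.
  move: e1 e2 e3 yxi; rewrite !ler_norml =>
    /andP[? ?] /andP[? ?] /andP[? ?] /andP[? ?].
  lra.
have [y yc yd] := main N (leqnn N); exists y => // i.
have cN : c + N%:R * h = d by rewrite mulrC hN; ring.
rewrite cN in yd; apply: (le_trans (yd i)).
have expN : (1 + K * h) ^+ N <= expR (K * (d - c)).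
  have -> : K * (d - c) = N%:R * (K * h) by rewrite -hN; ring.
  have Kh0 : 0 <= K * h by rewrite mulr_ge0.
  by rewrite expRM_natl lerXn2r ?nnegrE ?expR_ge0 ?expR_ge1Dx// addr_ge0.
have hE : K1 * h ^+ 2 * N%:R = K1 * (d - c) ^+ 2 / N%:R.
  by rewrite /h; field; rewrite gt_eqF.
rewrite mulrA hE -mulrA [_^-1 * _]mulrC mulrA ler_pM2r ?invr_gt0//.
by rewrite ler_wpM2l// mulr_ge0// exprn_ge0// subr_ge0.
Qed.

Lemma cyclic_flow_sc_minus c d x : 0 <= M -> c <= d -> flow c d x ->
  (sc_minus (x d) <= sc_minus (x c))%N.
Proof.
move=> M0 cd xf; have [K K0 KP] := cyclic_flow_sc_minus_approx M0 cd xf.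
have [e e0 eP] := nonzero_entries_gap (x d).
have dc0 : 0 <= d - c by rewrite subr_ge0.
have dcM0 : 0 <= (d - c) * M by rewrite mulr_ge0.
have Ke0 : 0 <= K / e by rewrite divr_ge0// ltW.
(* An [N] above this sum meets both constraints on the step size and makes [K / N] smaller than
   [e]. *)
have b0 : 0 <= (d - c) + (d - c) * M + K / e by lra.
have := archi_boundP b0; set N := Num.Def.archi_bound _ => bN.
have NR : 0 < N%:R :> R by lra.
have N0 : (0 < N)%N by rewrite -(ltr0n R).
have [||y yc yd] := KP N N0; [lra | lra |].
apply: leq_trans yc; apply: sc_minus_le_of_signs; apply: eP => k.
rewrite distrC; apply: (le_lt_trans (yd k)).
by rewrite ltr_pdivrMr// mulrC -ltr_pdivrMr//; lra.
Qed.

(** Backward from a zero, over a time at most [r] with [n * M * r <= 1 / 2], the Lipschitz estimate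
    halves any bound on [x]; iterating gives [x = 0] there, and short intervals are chained by
    [interval_additive_ind]. *)
Lemma cyclic_flow_eq0 c d x : 0 <= M -> c <= d -> flow c d x -> x d = 0 ->
  x c = 0.
Proof.
move=> M0 cd xf; have [X X0 xX] := cyclic_flow_bounded cd xf.
pose r := (2 * (n%:R * M + 1))^-1.
have r0 : 0 < r by rewrite invr_gt0 mulr_gt0// ltr_wpDl// mulr_ge0.
apply: (interval_additive_ind (Q := fun s t => x t = 0 -> x s = 0)) => //.
  by move=> s t u _ _ st tu /tu.
move=> T cT Td; exists (r / 2); first by rewrite divr_gt0.
move=> s t cs sT Tt td Tsr tTr xt0.
have half k u : s <= u -> u <= t -> forall i, `|x u i 0| <= X / 2 ^+ k.
  elim: k u => [|k IH] u su ut i; first by rewrite expr0 divr1 xX//; lra.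
  have ud : flow u t x by apply: cyclic_flowS xf; lra.
  have := cyclic_flow_lipschitz ut ud (X := X / 2 ^+ k) _ i.
  rewrite xt0 mxE sub0r normrN => /(_ _)/le_trans; apply.
    by move=> v /andP[uv vt] j; apply: IH => //; lra.
  have Xk : 0 <= X / 2 ^+ k by rewrite divr_ge0// exprn_ge0.
  rewrite (_ : X / 2 ^+ k.+1 = 2^-1 * (X / 2 ^+ k)); last
    by rewrite exprS invfM mulrCA.
  set Y := X / 2 ^+ k in Xk *.
  have tur : t - u <= r by lra.
  have nMr : n%:R * M * r <= 2^-1.
    rewrite /r invfM mulrCA ler_piMr// ler_pdivrMr ?mul1r; first lra.
    by rewrite ltr_wpDl// mulr_ge0.
  apply: (@le_trans _ _ (n%:R * M * r * Y)); last by rewrite ler_wpM2r.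
  by rewrite [n%:R * (M * Y)]mulrA mulrAC ler_wpM2r// ler_wpM2l// mulr_ge0.
apply/colP => i; rewrite mxE; apply/eqP;
  rewrite -normr_eq0 eq_le normr_ge0 andbT.
apply/ler_addgt0Pr => e e0; rewrite add0r.
have Xe : 0 <= X / e by rewrite divr_ge0// ltW.
have := archi_boundP Xe; set k := Num.Def.archi_bound _ => Xek.
apply: (le_trans (half k s _ _ i)); [lra | lra |].
rewrite ler_pdivrMr ?exprn_gt0// mulrC -ler_pdivrMr//;
  apply: (le_trans (ltW Xek)).
by rewrite -natrX ler_nat ltnW// ltn_expl.
Qed.

End CyclicFlowVD.

(** * Times at which the zeros are isolated *)

Section OpenIntervals.
Context {R : realType}.
Implicit Types (p q s t : R) (f : R -> R).

Lemma near_open_subitv p q s (P : R -> Prop) : p < s -> s < q ->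
  (\forall t \near s, P t) ->
  exists p' q', [/\ p <= p', p' < q', q' <= q & forall t, p' < t -> t < q' ->
    P t].
Proof.
move=> ps sq /nbhs_ballP[e /= e0 eP].
exists (Num.max p (s - e)), (Num.min q (s + e)); split.
- by rewrite le_max lexx.
- by rewrite lt_min !gt_max; apply/andP; split; apply/andP; split; lra.
- by rewrite ge_min lexx.
- move=> t; rewrite gt_max lt_min => /andP[_ ?] /andP[_ ?]; apply: eP.
  by rewrite /ball /= ltr_norml; lra.
Qed.

(** A finite Baire argument by induction on [l]: either the first closed set is the whole interval,
    or its complement contains a subinterval covered by the remaining sets. *)
Lemma finite_closed_cover_itv (I : eqType) (l : seq I) (P : I -> R ->
  Prop) p q :
  p < q ->
  (forall i s, p < s -> s < q -> ~ P i s -> \forall t \near s, ~ P i t) ->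
  (forall s, p < s -> s < q -> exists2 i, i \in l & P i s) ->
  exists i p' q', [/\ p <= p', p' < q', q' <= q & forall t, p' < t -> t < q' ->
    P i t].
Proof.
elim: l p q => [|i l IH] p q pq Pcl Pcov.
  by have [||i] := Pcov ((p + q) / 2); [lra | lra |].
have [Pi|] := pselect (forall t, p < t -> t < q -> P i t).
  by exists i, p, q; split.
move=> /existsNP[s /not_implyP[ps /not_implyP[sq nPs]]].
have [p' [q' [pp' pq' qq' nP]]] := near_open_subitv ps sq (Pcl _ _ ps sq nPs).
have [||j [p'' [q'' [? ? ? ?]]]] := IH p' q' pq'.
- by move=> j t pt tq; apply: Pcl; lra.
- move=> t pt tq; have [||j] := Pcov t; [lra | lra |].
  by rewrite inE => /orP[/eqP-> /(nP t pt tq)//|]; exists j.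
by exists j, p'', q''; split => //; lra.
Qed.

(** A nonzero value would persist on a subinterval, which has positive measure. *)
Lemma ae_eq0_continuous f p q :
  (forall t, p < t -> t < q -> {for t, continuous f}) ->
  {ae @lebesgue_measure R, forall t, p < t -> t < q -> f t = 0} ->
  forall t, p < t -> t < q -> f t = 0.
Proof.
move=> fc [N [mN N0 NN]] t pt tq; apply: contrapT => /eqP ft.
have nft : \forall u \near t, f u != 0 by exact: cvgr_neq0 (fc t pt tq) ft.
have [p' [q' [pp' pq' qq' nf]]] := near_open_subitv pt tq nft.
suff : (@lebesgue_measure R `]p', q'[%classic <= 0)%E.
  by rewrite lebesgue_measure_itv /= lte_fin pq' -EFinB lee_fin; lra.
have <- : @lebesgue_measure R N = 0%E by exact: N0.
apply: le_measure; rewrite ?inE; [exact: measurable_itv | exact: mN |].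
move=> u /=; rewrite in_itv /= => /andP[pu uq]; apply: NN => /=.
by move=> fu; have := nf u pu uq; rewrite fu ?eqxx//; lra.
Qed.

Lemma is_derive_near_cst f t (c l : R) :
  (\forall u \near t, f u = c) -> is_derive t 1 f l -> l = 0.
Proof.
move=> fc fl; have cl := near_eq_is_derive (g := cst c) fc fl.
by rewrite -(@derive_val _ _ _ _ _ _ _ cl) derive_cst.
Qed.

End OpenIntervals.

Section RingIndices.
Context {n : nat}.
Implicit Types (i j k : 'I_n).

Lemma val_iter_ordS l i : val (iter l (@ordS n) i) = ((i + l) %% n)%N.
Proof.
elim: l => [|l IH]; first by rewrite addn0 modn_small.
by rewrite iterS /= IH -addn1 modnDml addn1 addnS.
Qed.

Lemma iter_ordS_inj i l l' : (l < n)%N -> (l' < n)%N ->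
  iter l (@ordS n) i = iter l' (@ordS n) i -> l = l'.
Proof.
move=> ln ln' /(congr1 val); rewrite !val_iter_ordS => /eqP.
by rewrite eqn_modDl !modn_small// => /eqP.
Qed.

Lemma iter_ordS_onto i k : exists2 l, (l < n)%N & k = iter l (@ordS n) i.
Proof.
have n0 : (0 < n)%N by exact: leq_ltn_trans (ltn_ord i).
exists ((k + (n - i)) %% n)%N; first by rewrite ltn_mod.
apply: val_inj; rewrite val_iter_ordS modnDmr addnCA subnKC; last exact: ltnW.
by rewrite modnDr modn_small.
Qed.

End RingIndices.

Lemma connect_exit (T : finType) (e : rel T) (C : pred T) x y :
  connect e x y -> C x -> ~~ C y -> exists k j, [/\ C k, ~~ C j & e k j].
Proof.
move=> /connectP[r]; elim: r x => [x _ -> /= ->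
  //|z r IH x /= /andP[xz zr] yE Cx nCy].
have [Cz|nCz] := boolP (C z); first exact: IH zr yE Cz nCy.
by exists x, z.
Qed.

(** This is how zeros spread: with [y = x t], a coordinate that stays at zero has zero derivative,
    and a vanishing sum of terms of one weak sign has only zero terms. *)
Lemma Qplus_row_eq0 (R : realType) n (B : 'M[R]_n) (y : 'cV[R]_n) (k j : 'I_n) :
  in_Qplus B -> y k 0 = 0 -> 0 <= y (ordS k) 0 * y (ord_pred k) 0 ->
  (B *m y) k 0 = 0 -> B k j != 0 -> y j 0 = 0.
Proof.
move=> [Bm _ Bb] yk ySP; rewrite mxE => sum0 Bkj.
(* [e] carries the common weak sign of the two neighbours of [k], so that every
   term of [e * (B *m y) k 0] is nonnegative. *)
have [e [e0 eS eP]] : exists e : R,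
    [/\ e != 0, 0 <= e * y (ordS k) 0 & 0 <= e * y (ord_pred k) 0].
  have [S0|S0] := eqVneq (y (ordS k) 0) 0.
    have [P0|P0] := leP 0 (y (ord_pred k) 0).
      by exists 1; rewrite oner_eq0 S0 mulr0 mul1r.
    exists (-1); rewrite oppr_eq0 oner_eq0 S0 mulr0 mulN1r oppr_ge0; split=> //.
    exact: ltW.
  by exists (y (ordS k) 0); rewrite S0 -expr2 sqr_ge0.
have nn i : xpredT i -> 0 <= e * (B k i * y i 0).
  move=> _; rewrite mulrCA; have [->|Bki] := eqVneq (B k i) 0; first
    by rewrite mul0r.
  have [<-|ki] := eqVneq k i; first by rewrite yk !mulr0.
  rewrite mulr_ge0 ?Bm//; have [/eqP|->|->] := cyclic_bandP (Bb _ _ Bki) => //.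
  by rewrite (negPf ki).
have /eqP : e * \sum_i B k i * y i 0 = 0 by rewrite sum0 mulr0.
rewrite mulr_sumr psumr_eq0// => /allP/(_ j (mem_index_enum _)).
by rewrite /= !mulf_eq0 (negPf e0) (negPf Bkj) => /eqP.
Qed.

(** * Growth of arcs of zeros along the flow *)

Section IsolatedZeros.
Context {R : realType} {n : nat} {M : R} {A : R -> 'M[R]_n}.
Implicit Types (c d p q s t : R) (x : R -> 'cV[R]_n).

Local Notation flow := (cyclic_flow M A).

Lemma cyclic_flow_continuous c d x i t : flow c d x -> c < t -> t < d ->
  {for t, continuous (fun s => x s i 0)}.
Proof.
move=> [xac _] ct td; apply/cvgrPdist_lt => e e0.
have [r r0 rP] := abs_continuous_on_uniform (xac i) e0.
have r'0 : 0 < Num.min r (Num.min (t - c) (d - t))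
  by rewrite !lt_min r0 !subr_gt0 ct.
apply: filterS (nbhsx_ballx t _ r'0) => s; rewrite /ball /=.
rewrite !lt_min => /andP[sr /andP[/ltr_normlP[? ?] /ltr_normlP[? ?]]].
by apply: rP => //; lra.
Qed.

(* For [0 < m] the sign condition is automatic at both ends of the arc, one of
   the two neighbours being in the arc. *)
Definition zero_arc x p q i m : Prop :=
  (forall l, (l <= m)%N -> forall s, p < s -> s < q ->
    x s (iter l (@ordS n) i) 0 = 0) /\
  (m = 0%N -> forall s, p < s -> s < q -> 0 <=
    x s (ordS i) 0 * x s (ord_pred i) 0).

(** Irreducibility gives a nonzero entry [A t k j] with [k] in the arc and [j] outside, so [j] is
    one of the two indices bordering the arc and [Qplus_row_eq0] makes its coordinate vanish. Which
    border it is may depend on [t], hence the product. *)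
Lemma zero_arc_exit c d x p q i m : flow c d x -> c <= p -> q <= d ->
  (m.+1 < n)%N -> zero_arc x p q i m ->
  {ae @lebesgue_measure R, forall t, p < t -> t < q ->
     x t (iter m.+1 (@ordS n) i) 0 * x t (ord_pred i) 0 = 0}.
Proof.
move=> [_ xae] cp qd mn [z0 zm]; apply: filterS xae => t xt pt tq.
have [|AQ _ xd] := xt; first by lra.
pose C : pred 'I_n := [pred k | [exists l : 'I_m.+1, k == iter l (@ordS n) i]].
have Ci : C i by apply/existsP; exists ord0.
have CN : ~~ C (iter m.+1 (@ordS n) i).
  apply/existsP => -[l /eqP /iter_ordS_inj]; have := ltn_ord l.
  by move=> lm /(_ mn (ltn_trans lm mn)) E; move: lm; rewrite -E ltnn.
have [_ Airr _] := AQ.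
have [k [j [/existsP[l /eqP kE] nCj Akj]]] := connect_exit (Airr i _) Ci CN.
have C0 l' : (l' <= m)%N -> C (iter l' (@ordS n) i).
  by move=> lm; apply/existsP; exists (Ordinal (lm : (l' < m.+1)%N)).
have lm : (l <= m)%N by rewrite -ltnS.
have xk : x t k 0 = 0 by rewrite kE z0.
have dk0 : (A t *m x t) k 0 = 0.
  apply: is_derive_near_cst (xd k).
  near=> u; rewrite kE z0//; near: u; [exact: lt_nbhsr | exact: lt_nbhsl].
have kj : k != j.
  by apply: contraNneq nCj => <-; rewrite kE C0.
have [_ _ Ab] := AQ.
have pred_iter l' : ord_pred (iter l'.+1 (@ordS n) i) = iter l' (@ordS n) i.
  by rewrite iterS ordSK.
(* In an arc of at least two indices some neighbour of [k] lies in the arc, so the product is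
   zero. *)
have SP : 0 <= x t (ordS k) 0 * x t (ord_pred k) 0.
  case: (posnP m) => [m0|m0].
    have l0 : l = 0%N :> nat by apply/eqP; rewrite -leqn0 -m0.
    by rewrite kE l0; exact: zm.
  have [l0|l0] := posnP l.
    rewrite kE l0 -iterS (z0 1%N)// mul0r//.
  by rewrite kE -(prednK l0) pred_iter (z0 l.-1) ?mulr0// (leq_trans (leq_pred
    _)).
have xj := Qplus_row_eq0 AQ xk SP dk0 Akj.
have [/eqP|jS|jP] := cyclic_bandP (Ab _ _ Akj); first by rewrite (negPf kj).
  move: nCj xj; rewrite jS kE -iterS; have [lm' |ml] := ltnP l m.
    by rewrite C0.
  have -> : nat_of_ord l = m by apply/eqP; rewrite eqn_leq lm.
  by move=> _ ->; rewrite mul0r.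
move: nCj xj; rewrite jP kE; have [->|l0] := posnP l.
  by move=> _ /= ->; rewrite mulr0.
by rewrite -(prednK l0) pred_iter C0// (leq_trans (leq_pred _)).
Unshelve. all: by end_near. Qed.

(** By continuity the product of the border coordinates vanishes everywhere on the interval; the two
    closed zero sets cover it, so one border coordinate vanishes throughout a subinterval. *)
Lemma zero_arc_grow c d x p q i m : flow c d x -> c <= p -> p < q -> q <= d ->
  (m.+1 < n)%N -> zero_arc x p q i m ->
  exists p' q' i', [/\ p <= p', p' < q', q' <= q & zero_arc x p' q' i' m.+1].
Proof.
move=> xf cp pq qd mn za.
have xc j t : p < t -> t < q -> {for t, continuous (fun s => x s j 0)}.
  by move=> pt tq; apply: (@cyclic_flow_continuous c d x j t xf); lra.
pose e (b : bool) := if b then iter m.+1 (@ordS n) i else ord_pred i.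
have /ae_eq0_continuous prod0 := zero_arc_exit xf cp qd mn za.
have [||b [p' [q' [pp' pq' qq' xb]]]] :=
  @finite_closed_cover_itv R _ [:: true; false] (fun b t => x t (e b) 0 =
    0) p q pq.
- move=> b s ps sq /eqP xs.
  by apply: filterS (cvgr_neq0 _ (xc (e b) s ps sq) xs) => u /eqP.
- move=> s ps sq; have /eqP : x s (e true) 0 * x s (e false) 0 = 0.
    by apply: prod0 => // t pt tq; apply: continuousM; exact: xc.
  by rewrite mulf_eq0 => /orP[] /eqP ?; [exists true | exists false].
(* Growth at the far end keeps the starting index; growth at the near end moves it back by one. *)
exists p', q', (if b then i else ord_pred i); split=> //;
  split=> // l lm s ps sq.
have [ps' sq'] : p < s /\ s < q by lra.
case: b xb => xb.
  move: lm; rewrite leq_eqVlt => /orP[/eqP->|lm]; first exact: xb.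
  by apply: za.1.
case: l lm => [_|l lm]; first exact: xb.
by rewrite iterSr ord_predK; exact: za.1.
Qed.

Lemma cyclic_flow_isolated_zeros c d x : c < d -> flow c d x ->
  (forall t, c <= t <= d -> x t != 0) ->
  exists2 s, c <= s <= d & isolated_zeros (x s).
Proof.
move=> cd xf x0; apply: contrapT => nreg.
have xc j t : c < t -> t < d -> {for t, continuous (fun s => x s j 0)}.
  by move=> ct td; exact: (@cyclic_flow_continuous c d x j t xf).
pose bad i s := x s i 0 = 0 /\ 0 <= x s (ordS i) 0 * x s (ord_pred i) 0.
have [||i [p [q [cp pq qd bi]]]] :=
  @finite_closed_cover_itv R _ (enum 'I_n) bad c d cd.
- move=> i s cs sd /not_andP[/eqP xs|/negP].
    apply: filterS (cvgr_neq0 _ (xc i s cs sd) xs) => u /eqP xu.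
    by move=> [/xu].
  rewrite -ltNge => xx.
  have := @continuousM _ _ _ _ _ (xc (ordS i) s cs sd) (xc (ord_pred i) s cs
    sd).
  move=> /cvgr_lt/(_ 0 xx); apply: filterS => u /= xu [_].
  by rewrite leNgt xu.
- move=> s cs sd; apply: contrapT => nbad; apply: nreg; exists s; first lra.
  move=> i xi; rewrite ltNge; apply/negP => xx; apply: nbad.
  by exists i => //; rewrite mem_enum.
have n0 : (0 < n)%N by exact: leq_ltn_trans (ltn_ord i).
have arc m : (m < n)%N -> exists p' q' i',
    [/\ p <= p', p' < q', q' <= q & zero_arc x p' q' i' m].
  elim: m => [_|m IH mn].
    exists p, q, i; split=> //; split => [l|_ s ps sq]; last
      by have [] := bi s ps sq.
    by rewrite leqn0 => /eqP-> s ps sq; have [] := bi s ps sq.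
  have [p' [q' [j [pp' pq' qq' za]]]] := IH (ltnW mn).
  have [||p'' [q'' [k [? ? ? ?]]]] := zero_arc_grow xf _ pq' _ mn za;
    [lra | lra |].
  by exists p'', q'', k; split=> //; lra.
(* A [zero_arc] of parameter [m] has [m + 1] indices, so [n.-1] gives the whole ring. *)
have [|p' [q' [j [pp' pq' qq' za]]]] := arc n.-1; first by rewrite prednK.
pose s := (p' + q') / 2; have ps : p' < s by rewrite /s; lra.
have sq : s < q' by rewrite /s; lra.
have /eqP[] : x s != 0 by apply: x0; lra.
apply/colP => k; rewrite mxE; have [l ln ->] := iter_ordS_onto j k.
by apply: za.1 => //; rewrite -ltnS prednK.
Qed.

End IsolatedZeros.

(** * The transition matrix *)

(** One [M] serves every [v], as the sum of the essential bounds of the finitely many entries on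
    [[t0, t]]; the equation passes from [Phi] to [Phi s *m v] by linearity. *)
Lemma transition_cyclic_flow (R : realType) n (a b : \bar R) (A Phi : R ->
  'M[R]_n)
    (t0 t : R) :
  (forall i j, locally_ess_bounded a b (fun t => A t i j)) ->
  {ae @lebesgue_measure R, forall t, open_itv a b t -> in_Qplus (A t)} ->
  is_transition_matrix a b A t0 Phi ->
  open_itv a b t0 -> open_itv a b t -> t0 < t ->
  exists2 M : R, 0 <= M &
    forall v : 'cV[R]_n, cyclic_flow M A t0 t (fun s => Phi s *m v).
Proof.
move=> Ab AQ [Phiac _ Phid] abt0 abt t0t.
have /choice[N NP] (p : 'I_n * 'I_n) := Ab p.1 p.2 t0 t abt0 abt.
have AN : {ae @lebesgue_measure R, forall s (p : 'I_n * 'I_n),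
    t0 <= s <= t -> `|A s p.1 p.2| <= N p} by exact: filter_forall.
have abs s : t0 <= s <= t -> open_itv a b s.
  move=> /andP[t0s st]; split; first exact: lt_le_trans abt0.1 _.
  exact: le_lt_trans abt.2.
exists (\sum_p `|N p|); first by apply: sumr_ge0.
move=> v; split=> [i|].
  have -> : (fun s => (Phi s *m v) i 0) = (fun s => \sum_j Phi s i j * v j 0).
    by apply/funext => s; rewrite mxE.
  apply: abs_continuous_on_sum => j; apply: abs_continuous_onZ.
  exact: Phiac.
apply: filterS3 AN AQ Phid => s ANs AQs Phids st; split.
- exact/AQs/abs.
- move=> i j; apply: (le_trans (ANs (i, j) st)); apply: (le_trans (ler_norm _)).
  by rewrite (bigD1 (i, j))//= lerDl sumr_ge0.
- move=> i; have dPhi j := Phids (abs _ st) i j.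
  have -> : (fun s => (Phi s *m v) i 0) = \sum_(j < n) (v j 0 *: (fun s =>
    Phi s i j)).
    apply/funext => u; rewrite mxE fct_sumE; apply: eq_bigr => j _.
    by rewrite mulrC.
  have -> : (A s *m (Phi s *m v)) i 0 =
    \sum_(j < n) v j 0 *: (A s *m Phi s) i j.
    by rewrite mulmxA mxE; apply: eq_bigr => j _; rewrite mulrC.
  by apply: is_derive_sum => j; exact: is_deriveZ.
Qed.

Lemma unitmx_of_ker (F : fieldType) n (B : 'M[F]_n) :
  (forall v : 'cV[F]_n, B *m v = 0 -> v = 0) -> B \in unitmx.
Proof.
move=> inj; rewrite -unitmx_tr -row_free_unit -kermx_eq0;
  apply/eqP/row_matrixP => i.
rewrite row0; apply: trmx_inj; rewrite trmx0; apply: inj.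
apply: trmx_inj; rewrite trmx_mul trmxK trmx0.
by rewrite -row_mul mulmx_ker row0.
Qed.

Theorem theorem7 (R : realType) (n : nat) (a b : \bar R) (A : R -> 'M[R]_n)
  (A_meas : forall i j : 'I_n,
     lebesgue_measurable_fun (open_itv a b) (fun t => A t i j))
  (A_bounded : forall i j : 'I_n,
     locally_ess_bounded a b (fun t => A t i j))
  (A_Qplus : {ae @lebesgue_measure R, forall t,
     open_itv a b t -> in_Qplus (A t)})
  (A_delta : exists2 delta : R, 0 < delta &
     {ae @lebesgue_measure R, forall t, open_itv a b t ->
        forall i j : 'I_n, A t i j != 0 -> delta <= A t i j}) :
  CVDDS a b A.
Proof.
move=> t0 t abt0 abt t0t Phi tPhi x x0.
have [M M0 flow] := transition_cyclic_flow A_bounded A_Qplus tPhi abt0 abt t0t.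
have [_ Phi0 _] := tPhi.
have Phi_inj s (v : 'cV[R]_n) : t0 <= s <= t -> Phi s *m v = 0 -> v = 0.
  move=> /andP[t0s st] Phiv.
  have := cyclic_flow_eq0 M0 t0s (cyclic_flowS (lexx _) st (flow v)) Phiv.
  by rewrite Phi0 mul1mx.
have [s|s st0t reg] := cyclic_flow_isolated_zeros t0t (flow x).
  by move=> st; apply: contraNneq x0 => /(Phi_inj _ _ st) ->.
have /andP[t0s st] := st0t.
have [e e0 eP] := nonzero_entries_gap (Phi s *m x).
apply: sc_plus_le => w w0 wE.
have Phi_unit : Phi t \in unitmx by apply: unitmx_of_ker => v; apply: Phi_inj;
  lra.
have [y yE] : exists y, Phi t *m x = y by eexists.
rewrite yE in wE.
(* [p] carries the filling values at the zeros of [Phi t *m x]. Starting from [x + r *: u] the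
   solution is [y + r *: p] at time [t], with the signs of [w], and [Phi s *m x + r *: q] at time
   [s]. *)
pose p : 'cV[R]_n := \col_k if y k 0 == 0 then w k 0 else 0.
pose u := invmx (Phi t) *m p; pose q := Phi s *m u.
pose S := \sum_k `|q k 0|; have S0 : 0 <= S by apply: sumr_ge0.
(* This makes each entry of [r *: q] smaller than [e]; the [1] covers the case [q = 0]. *)
pose r := e / (1 + S); have r0 : 0 < r by rewrite divr_gt0// ltr_wpDr.
have wt : sc_minus w = sc_minus (Phi t *m (x + r *: u)).
  apply: eq_sc_minus => k.
  rewrite mulmxDr -scalemxAr mulmxA mulmxV// mul1mx yE !mxE.
  have [yk|yk] := eqVneq (y k 0) 0; last by rewrite mulr0 addr0 wE.
  by rewrite yk add0r sgrM (gtr0_sg r0) mul1r.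
(* The count is followed back in time: from [t] to [s] along the perturbed solution, then at [s] to
   the unperturbed one, whose zeros are isolated, and finally from [s] to [t0]. *)
rewrite wt; have xs v := cyclic_flow_sc_minus M0 st (cyclic_flowS t0s (lexx _)
  (flow v)).
apply: leq_trans (xs _) _.
have x0s := cyclic_flow_sc_minus M0 t0s (cyclic_flowS (lexx _) st (flow x)).
rewrite Phi0 mul1mx in x0s; apply: leq_trans x0s.
apply: (isolated_zeros_sc_minus_ge reg); apply: eP => k.
rewrite mulmxDr -scalemxAr -/q mxE [X in X - _]addrC addrK mxE normrM
  gtr0_norm//.
rewrite /r mulrAC ltr_pdivrMr ?ltr_wpDr// ltr_pM2l//.
by rewrite /S (bigD1 k)//= [X in _ < X]addrCA ltrDl ltr_wpDr// sumr_ge0.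
Qed.
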